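(* Let $a,c>0$. For each $\tau>0$ let $(Y_t^{(a,c)})_{t\in[0,\tau]}$ be the Markov process on $[0,\tau]$ defined in the context. Then, as $\tau\to\infty$, the finite dimensional distributions of $(Y_t^{(a,c)})_{t\in[0,\tau]}$ converge weakly to those of $(Z_t^{(c)})_{t\ge0}$ (i.e. for any fixed times $0\le t_1<\dots<t_n$, the law of $(Y^{(a,c)}_{t_1},\dots,Y^{(a,c)}_{t_n})$ converges weakly to the law of $(Z^{(c)}_{t_1},\dots,Z^{(c)}_{t_n})$), where $(Z_t^{(c)})_{t\ge0}$ is the real-valued Markov process with initial distribution $$\mathbb{P}(Z_0^{(c)}\in dx)=\frac{4\,e^{-cx}K_0(e^{-x})}{2^c\,\Gamma(c/2)^2}\,dx$$ and transition probabilities $$\mathbb{P}(Z_t^{(c)}\in dy\mid Z_s^{(c)}=x)=\frac{K_0(e^{-y})}{K_0(e^{-x})}\,p_{t-s}(x,y)\,dy,\qquad 0\le s<t.$$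
   Context: For $x>0$ and complex $z$, $K_z(x)=\int_0^\infty e^{-x\cosh w}\cosh(zw)\,dw$ is the modified Bessel function. The Yakubovich heat kernel is $$p_t(x,y)=\frac{2}{\pi}\int_0^\infty e^{-tu^2/4}K_{iu}(e^{-x})K_{iu}(e^{-y})\frac{du}{|\Gamma(iu)|^2},\quad x,y\in\mathbb{R},\ t>0.$$ For $\tau>0$ and real $a,c$ with $a+c>0$, the process $(Y_t^{(a,c)})_{t\in[0,\tau]}$ (which depends on $\tau$) is the real-valued Markov process with transition probabilities $\mathbb{P}(Y_t^{(a,c)}\in dy\mid Y_s^{(a,c)}=x)=\frac{H_t(y)}{H_s(x)}p_{t-s}(x,y)\,dy$, $0\le s<t\le\tau$, and initial distribution $\mathbb{P}(Y_0^{(a,c)}\in dx)=\frac{1}{C^{(\tau)}_{a,c}}e^{-cx}H_0(x)\,dx$, where $$C^{(\tau)}_{a,c}=\int_{\mathbb{R}^2}e^{-ax-cy}p_\tau(x,y)\,dx\,dy,\quad H_t(x)=\int_{\mathbb{R}}e^{-ay}p_{\tau-t}(x,y)\,dy\ (0\le t<\tau),\quad H_\tau(x)=e^{-ax}.$$ *)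

(* Defs.v *)
From HB Require Import structures.
From mathcomp Require Import all_boot all_order all_algebra.
From mathcomp Require Import all_classical all_reals all_analysis measurable_realfun.
From mathcomp Require Import complex.

Set Implicit Arguments.
Unset Strict Implicit.
Unset Printing Implicit Defensive.
Import Order.TTheory GRing.Theory Num.Theory.
Import numFieldNormedType.Exports.

Local Open Scope classical_set_scope.
Local Open Scope ring_scope.
Local Open Scope complex_scope.

Section SpecialFunctions.
Context {R : realType}.
Implicit Types (z : R[i]) (x y t u : R).

Local Notation mu := (@lebesgue_measure R).

Definition cexp z : R[i] :=
  (expR (complex.Re z) * cos (complex.Im z)) +i*
  (expR (complex.Re z) * sin (complex.Im z)).

Definition ccosh z : R[i] := (cexp z + cexp (- z)) / 2%:R.

Definition cosh x : R := (expR x + expR (- x)) / 2.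

Definition cintegral (D : set R) (f : R -> R[i]) : R[i] :=
  (\int[mu]_(x in D) complex.Re (f x)) +i*
  (\int[mu]_(x in D) complex.Im (f x)).

Definition euler_integral z : R[i] :=
  cintegral `]0, +oo[
    (fun s => cexp ((z - 1) * (ln s)%:C) * (expR (- s))%:C).

(* Gamma on C minus {0, -1, -2, ...}: Euler's integral for 0 < Re z, and
   elsewhere its analytic continuation by the functional equation
   Gamma(z) = Gamma(z + n) / (z (z + 1) ... (z + n - 1)), with n the least
   shift such that 0 < Re (z + n).  At z = iu, where Euler's integral diverges,
   n = 1. *)
Definition Gamma z : R[i] :=
  let n := Num.truncn (1 - complex.Re z) in
  euler_integral (z + n%:R) / \prod_(k < n) (z + k%:R).

Definition besselK z x : R[i] :=
  cintegral `]0, +oo[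
    (fun w => (expR (- (x * cosh w)))%:C * ccosh (z * w%:C)).

(* K_{iu}(x) and K_0(x) are real numbers; [complex.Re] only changes the type. *)
Definition besselK_i u x : R := complex.Re (besselK (0 +i* u) x).
Definition besselK0 x : R := complex.Re (besselK 0 x).

Definition heat_kernel t x y : R :=
  2 / pi * \int[mu]_(u in `]0, +oo[)
    (expR (- (t * u ^+ 2 / 4))
     * besselK_i u (expR (- x)) * besselK_i u (expR (- y))
     / (ComplexField.Normc.normc (Gamma (0 +i* u))) ^+ 2).

Definition C_const (a c tau : R) : R :=
  \int[(mu \x mu)%E]_xy
    (expR (- (a * xy.1) - c * xy.2) * heat_kernel tau xy.1 xy.2).

Definition H (a tau t x : R) : R :=
  if t < tau then \int[mu]_y (expR (- (a * y)) * heat_kernel (tau - t) x y)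
  else expR (- (a * x)).

Definition Y_initial_density (a c tau x : R) : R :=
  (C_const a c tau)^-1 * expR (- (c * x)) * H a tau 0 x.

Definition Y_transition_density (a tau s t x y : R) : R :=
  H a tau t y / H a tau s x * heat_kernel (t - s) x y.

(* Gamma(c/2) is a real number for c > 0. *)
Definition Z_initial_density (c x : R) : R :=
  4 * expR (- (c * x)) * besselK0 (expR (- x))
  / (2 `^ c * complex.Re (Gamma (c / 2)%:C) ^+ 2).

Definition Z_transition_density (s t x y : R) : R :=
  besselK0 (expR (- y)) / besselK0 (expR (- x)) * heat_kernel (t - s) x y.

End SpecialFunctions.

Section Processes.
Context {R : realType} {d : measure_display} {T : measurableType d}.
Variable P : probability T R.

Local Notation mu := (@lebesgue_measure R).

Definition natural_filtration (I : set R) (X : R -> {RV P >-> R}) (s : R) :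
    set (set T) :=
  <<s [set A | exists r B, [/\ I r, r <= s, measurable B
                             & A = X r @^-1` B] ] >>.

Definition transition_probability (q : R -> R -> R -> R -> R) (s t x : R)
    (B : set R) : \bar R :=
  (\int[mu]_(y in B) (q s t x y)%:E)%E.

(* (X_t), t in I, is a Markov process with initial density f0 (at time 0) and
   transition densities q s t x y = P(X_t in dy | X_s = x) / dy.  The last
   clause says that the integral over B of q s t (X_s) is a version of the conditional
   probability P(X_t in B | X_r, r in I, r <= s).  The variables X_t with t
   outside I are irrelevant. *)
Definition markov_process (I : set R) (X : R -> {RV P >-> R})
    (f0 : R -> R) (q : R -> R -> R -> R -> R) : Prop :=
  [/\ forall B : set R, measurable B ->
        (P (X 0%R @^-1` B) = \int[mu]_(x in B) (f0 x)%:E)%E,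
      forall (s t : R) (B : set R), I s -> I t -> s < t -> measurable B ->
        measurable_fun [set: R]
          (transition_probability q s t ^~ B)
    & forall (s t : R) (B : set R) (A : set T),
        I s -> I t -> s < t -> measurable B -> natural_filtration I X s A ->
        (P (A `&` X t @^-1` B) =
         \int[P]_(w in A) transition_probability q s t (X s w) B)%E].

Definition joint (X : R -> {RV P >-> R}) n (t : 'I_n -> R) (w : T) :
    n.-tuple R := [tuple X (t i) w | i < n].

Lemma measurable_joint X n (t : 'I_n -> R) :
  measurable_fun [set: T] (joint X t).
Proof.
apply/measurable_fun_tnthP => i.
rewrite (_ : _ \o _ = X (t i)); first exact: measurable_funPT.
by apply/funext => w /=; rewrite tnth_mktuple.
Qed.

HB.instance Definition _ X n (t : 'I_n -> R) :=
  isMeasurableFun.Build _ _ _ _ (joint X t) (measurable_joint X t).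

Definition joint_law (X : R -> {RV P >-> R}) n (t : 'I_n -> R) :
    probability (n.-tuple R) R :=
  distribution P (joint X t).

End Processes.

(* Weak convergence, as the parameter tends to +oo, of laws on R^n: n.-tuple R
   carries the product sigma-algebra and 'rV[R]_n the topology. *)
Definition weakly_converges {R : realType} n
    (nu_ : R -> probability (n.-tuple R) R) (nu : probability (n.-tuple R) R) :
    Prop :=
  forall g : 'rV[R]_n -> R, continuous g ->
    (exists M : R, forall v, `|g v| <= M) ->
    \int[nu_ tau]_x g (\row_i tnth x i) @[tau --> +oo] -->
    \int[nu]_x g (\row_i tnth x i).

(* Main.v *)
From HB Require Import structures.
Require Import Defs.
From mathcomp Require Import all_boot all_order all_algebra.
From mathcomp Require Import all_classical all_reals all_analysis measurable_realfun.
From mathcomp Require Import complex ring.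
Import Order.TTheory GRing.Theory Num.Theory.
Import numFieldNormedType.Exports.
Local Open Scope classical_set_scope.
Local Open Scope ring_scope.

(* Write [K u y] for [K_{iu}(e^-y)] and [p_t] for the heat kernel.  Since
   [|Gamma(iu)|^-2] grows slower than any [exp (e * u ^ 2)], the measures
   [exp (- t * u ^ 2 / 4) / |Gamma(iu)|^2 du], normalised by their mass [m t],
   concentrate at [u = 0] as [t --> +oo].  Hence [p_t (x, y) / m t] tends to
   [K 0 x * K 0 y] (up to the factor [2 / pi]), dominated by its limit, so that
   [H_t / C] tends to a multiple of [K 0].

   On the events up to time [t] the law of [Y] has density
   [D_t (Z_t) = const * H_t (Z_t) / (C * K 0 (Z_t))] with respect to the law of
   [Z], because the Markov kernels of both processes are h-transforms of [p].
   This density is bounded and tends to 1, and bounded convergence concludes.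
   The facts that are delicate to prove directly from the formulas, namely
   [p_t >= 0], the total mass of the transition kernels and the values of the
   normalising constants, follow from the existence of the processes. *)

(** * Integration *)

Section Integration.
Set Implicit Arguments.
Unset Strict Implicit.
Context {R : realType}.

(** The growth bound on [|Gamma(iu)|^-2] is derived from Euler's integral. For [N >= 8 * u ^ 2] the
    weight [s ^ N * expR (- s)] is so concentrated near [s = N] that the phase [u * ln s] varies
    little there, whence [|Gamma(N + 1 + iu)| >= Gamma(N + 1) / 2]. The functional equation then
    descends from [N] to [0], and its factors cost at most [C * expR (e * u ^ 2)].

    All dominations rest on [|K u y| <= K 0 y], that is, on [|cos| <= 1] inside the integral. It
    makes the limit of the normalised kernels their dominating function as well, and it bounds the
    density [D_t] uniformly in the position although [1 / K 0] is unbounded.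

    The heat kernels between successive times are common to both processes, so the density sees only
    the final position, and a single function of one variable has to converge. The one gap in this
    cancellation is that [H_t], which stands in a denominator, might vanish somewhere; the points
    where it does are shown to be negligible for the law of [Z]. *)

Lemma le_integrable_EFin d (T : measurableType d)
    (m : {measure set T -> \bar R}) (D : set T) (f g : T -> R) :
  measurable D -> measurable_fun D f ->
  (forall x, D x -> `|f x| <= g x) ->
  m.-integrable D (EFin \o g) -> m.-integrable D (EFin \o f).
Proof.
move=> mD mf fg; apply: le_integrable => //; first exact/measurable_EFinP.
by move=> x Dx; rewrite /= lee_fin (le_trans (fg _ Dx))// ler_norm.
Qed.

Lemma integrable_EFinZl d (T : measurableType d)
    (m : {measure set T -> \bar R}) (D : set T) (f : T -> R) (k : R) :
  measurable D -> m.-integrable D (EFin \o f) ->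
  m.-integrable D (EFin \o (fun x => k * f x)).
Proof.
by move=> mD intf; apply: eq_integrable (integrableZl mD k intf).
Qed.

Lemma integrable_EFinD d (T : measurableType d)
    (m : {measure set T -> \bar R}) (D : set T) (f g : T -> R) :
  measurable D -> m.-integrable D (EFin \o f) -> m.-integrable D (EFin \o g) ->
  m.-integrable D (EFin \o (fun x => f x + g x)).
Proof.
by move=> mD intf intg; apply: eq_integrable (integrableD mD intf intg) => // x _.
Qed.

Lemma integrable_EFinB d (T : measurableType d)
    (m : {measure set T -> \bar R}) (D : set T) (f g : T -> R) :
  measurable D -> m.-integrable D (EFin \o f) -> m.-integrable D (EFin \o g) ->
  m.-integrable D (EFin \o (fun x => f x - g x)).
Proof.
by move=> mD intf intg; apply: eq_integrable (integrableB mD intf intg) => // x _.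
Qed.

(** A positive inverse is [expR (- ln f)], a composition of measurable functions. *)
Lemma measurable_funV_gt0 d (T : measurableType d) (f : T -> R) :
  (forall x, 0 < f x) -> measurable_fun setT f ->
  measurable_fun setT (fun x => (f x)^-1).
Proof.
move=> f0 mf; under eq_fun do rewrite -[f _]lnK ?posrE// -expRN.
apply: measurableT_comp => //; apply: measurableT_comp => //.
exact: (measurableT_comp (@measurable_ln R) mf).
Qed.

Lemma dominated_cvg_Rintegral d (T : measurableType d)
    (m : {measure set T -> \bar R}) (D : set T) (f_ : nat -> T -> R)
    (f g : T -> R) :
  measurable D -> (forall n, measurable_fun D (f_ n)) ->
  (forall x, D x -> f_ ^~ x @ \oo --> f x) ->
  m.-integrable D (EFin \o g) ->
  (forall n x, D x -> `|f_ n x| <= g x) ->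
  \int[m]_(x in D) f_ n x @[n --> \oo] --> \int[m]_(x in D) f x.
Proof.
move=> mD mf ff ig fg.
have mfl : measurable_fun D f by exact: (measurable_fun_cvg mf ff).
have fle x : D x -> `|f x| <= g x.
  move=> Dx; apply: (cvgr_to_le (cvg_norm (ff _ Dx))).
  by apply: nearW => n; exact: fg.
have intf : m.-integrable D (EFin \o f) by exact: (le_integrable_EFin mD mfl fle ig).
apply: fine_cvg; rewrite fineK; last exact: integrable_fin_num.
apply: (@dominated_cvg _ _ _ m D mD (fun n => EFin \o f_ n) (EFin \o f)
  (EFin \o g)) => //.
- by move=> n; exact/measurable_EFinP.
- by move=> x Dx; apply: cvg_EFin; [exact: nearW|exact: ff].
Qed.

(** No integrability is assumed: Tonelli's theorem gives the measurability of the integrals of the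
    positive and of the negative part, and [fine] of their difference is the real integral. The
    domain enters as an indicator factor. *)
Lemma measurable_Rintegral d1 d2 (T1 : measurableType d1)
    (T2 : measurableType d2) (m : {sigma_finite_measure set T2 -> \bar R})
    (D : set T2) (f : T1 -> T2 -> R) : measurable D ->
  measurable_fun setT (fun z : T1 * T2 => f z.1 z.2) ->
  measurable_fun setT (fun x => \int[m]_(y in D) f x y).
Proof.
move=> mD mf.
pose g (z : T1 * T2) : \bar R := (EFin \o (fun z => f z.1 z.2 * \1_D z.2)) z.
have mg : measurable_fun setT g.
  apply/measurable_EFinP; apply: measurable_funM => //.
  exact/(measurableT_comp (measurable_indic mD)).
have E : (fun x => \int[m]_(y in D) f x y) =
    (fun x => fine (fubini_F m g^\+ x - fubini_F m g^\- x)%E).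
  apply/funext => x; rewrite /Rintegral integral_mkcond integralE /fubini_F.
  congr (fine (_ - _)%E); apply: eq_integral => y _;
  rewrite ?funeposE ?funenegE /g /= patchE indicE; case: ifP => _;
  by rewrite ?mulr1 ?mulr0.
rewrite E; apply: measurableT_comp => //; apply: emeasurable_funB.
- apply: measurable_fun_fubini_tonelli_F; [exact: measurable_funepos|].
  exact: funepos_ge0.
- apply: measurable_fun_fubini_tonelli_F; [exact: measurable_funeneg|].
  exact: funeneg_ge0.
Qed.

(** If the integral were [0], [f] would vanish almost everywhere on [D], and [D] would be null. *)
Lemma Rintegral_gt0 d (T : measurableType d)
    (m : {measure set T -> \bar R}) (D : set T) (f : T -> R) :
  measurable D -> m.-integrable D (EFin \o f) ->
  (forall x, D x -> 0 < f x) -> (0 < m D)%E -> 0 < \int[m]_(x in D) f x.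
Proof.
move=> mD intf f0 mD0; rewrite lt_neqAle Rintegral_ge0 ?andbT; last first.
  by move=> x /f0/ltW.
apply/eqP => If0.
have mf : measurable_fun D (EFin \o f) by exact: (measurable_int m).
have /(ae_eq_integral_abs m mD mf) : (\int[m]_(x in D) `|(EFin \o f) x| = 0)%E.
  transitivity (\int[m]_(x in D) (f x)%:E)%E.
    by apply: eq_integral => x /set_mem/f0/ltW fx /=; rewrite ger0_norm.
  by rewrite -[LHS]fineK ?integrable_fin_num//; rewrite -/(Rintegral _ _ _) -If0.
move=> [N [mN N0 DN]]; move: mD0; apply/negP; rewrite -leNgt -N0.
apply: le_measure; rewrite ?inE// => x Dx; apply: DN => /= /(_ Dx) [fx0].
by have := f0 _ Dx; rewrite fx0 ltxx.
Qed.

Lemma lebesgue_measure_itvoo_gt0 (a b : R) : a < b ->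
  (0 < @lebesgue_measure R `]a, b[)%E.
Proof. by move=> ab; rewrite lebesgue_measure_itv/= lte_fin ab lte_fin subr_gt0. Qed.

Lemma lebesgue_measure_itvoy_gt0 (a : R) : (0 < @lebesgue_measure R `]a, +oo[)%E.
Proof. by rewrite lebesgue_measure_itv/= ltry addye// ltNye. Qed.

Lemma integrable_expRN (k : R) : 0 < k ->
  (@lebesgue_measure R).-integrable `]0, +oo[ (EFin \o (fun x => expR (- (k * x)))).
Proof.
move=> k0; have : (@lebesgue_measure R).-integrable `]0, +oo[
    (EFin \o exponential_pdf k).
  by apply: integrableS (integrable_exponential_pdf k0).
move=> intp; apply: eq_integrable (integrableZl _ k^-1 intp) => // x; rewrite inE/= in_itv/= andbT => x0.
by rewrite /= exponential_pdfE ?ltW// -EFinM mulrA mulVf ?gt_eqF// mul1r mulNr.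
Qed.

Lemma integrable_expRN_norm (k : R) : 0 < k ->
  (@lebesgue_measure R).-integrable setT (EFin \o (fun x => expR (- (k * `|x|)))).
Proof.
move=> k0; have mf : measurable_fun setT (fun x : R => expR (- (k * `|x|))).
  apply: measurableT_comp => //; apply: measurableT_comp => //.
  by apply: measurable_funM => //; exact: measurable_normr.
apply/integrableP; split; first exact/measurable_EFinP.
under eq_integral do rewrite gee0_abs ?lee_fin ?expR_ge0//.
rewrite ge0_symfun_integralT//.
- rewrite -set_itvcy -integral_itv_obnd_cbnd; last exact/measurable_EFinP/measurable_funTS.
  apply: lte_mul_pinfty => //; have /integrableP[_] := integrable_expRN k0.
  apply: le_lt_trans; rewrite le_eqVlt; apply/orP; left; apply/eqP.
  apply: eq_integral => x; rewrite inE/= in_itv/= andbT => x0.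
  by rewrite /= (ger0_norm (ltW x0)) (ger0_norm (expR_ge0 _)).
- move=> x; apply: continuous_comp; last exact: continuous_expR.
  apply: (@continuousN _ R^o); apply: (@continuousM _ R^o); first exact: cst_continuous.
  exact: norm_continuous.
- by move=> x /=; rewrite normrN.
Qed.

Import HBNNSimple.

Lemma weighted_integral_nnsfun d1 d2 (T : measurableType d1)
    (V : measurableType d2) (m : {measure set T -> \bar R}) (A : set T)
    (X : T -> V) (k : T -> \bar R) (h : {nnsfun V >-> R}) :
  measurable A -> measurable_fun setT X -> measurable_fun setT k ->
  (forall x, 0 <= k x)%E ->
  (\int[m]_(x in A) ((h (X x))%:E * k x) =
   \sum_(r \in range h)
     r%:E * \int[m]_(x in A `&` X @^-1` (h @^-1` [set r])) k x)%E.
Proof.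
move=> mA mX mk k0.
have mXr r : measurable (X @^-1` (h @^-1` [set r])).
  by rewrite -[X in measurable X]setTI; apply: mX => //; exact: measurable_sfunP.
transitivity (\int[m]_(x in A) (\sum_(r \in range h)
    (r * \1_(h @^-1` [set r]) (X x))%:E * k x))%E.
  apply: eq_integral => x _; rewrite fimfunE -fsumEFin//.
  rewrite ge0_mule_fsuml// => r; exact: nnfun_muleindic_ge0.
rewrite ge0_integral_fsum//; last 2 first.
- move=> r; apply: emeasurable_funM; last exact: measurable_funTS.
  apply/measurable_EFinP; apply: measurable_funM => //.
  apply: measurable_funTS; apply: (measurableT_comp _ mX).
  by apply: measurable_indic; exact: measurable_sfunP.
- by move=> r x _; rewrite mule_ge0//; exact: nnfun_muleindic_ge0.
apply: eq_fsbigr => r /set_mem [v _ rv].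
transitivity (\int[m]_(x in A) (r%:E * ((\1_(X @^-1` (h @^-1` [set r])) x)%:E * k x)))%E.
  by apply: eq_integral => x _; rewrite EFinM -muleA.
rewrite ge0_integralZl//; last 3 first.
- apply: emeasurable_funM; last exact: measurable_funTS.
  by apply/measurable_EFinP; exact: measurable_indic.
- by move=> x _; rewrite mule_ge0// lee_fin.
- by rewrite lee_fin -rv fun_ge0.
congr (_ * _)%E; rewrite integral_mkcondr; apply: eq_integral => x _.
rewrite patchE indicE; case: ifP => _; by rewrite ?mul1e ?mul0e.
Qed.

(** Two image measures with densities that agree on measurable sets give the same integrals: simple
    functions, then monotone convergence. With [k1 = 1] it transfers an expectation under one law to
    a weighted expectation under another. *)
Lemma eq_weighted_integral d1 d2 d3 (T1 : measurableType d1)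
    (T2 : measurableType d2) (V : measurableType d3)
    (m1 : {measure set T1 -> \bar R}) (m2 : {measure set T2 -> \bar R})
    (A1 : set T1) (A2 : set T2) (X1 : T1 -> V) (X2 : T2 -> V)
    (k1 : T1 -> \bar R) (k2 : T2 -> \bar R) :
  measurable A1 -> measurable A2 ->
  measurable_fun setT X1 -> measurable_fun setT X2 ->
  measurable_fun setT k1 -> measurable_fun setT k2 ->
  (forall x, 0 <= k1 x)%E -> (forall x, 0 <= k2 x)%E ->
  (forall B, measurable B ->
    \int[m1]_(x in A1 `&` X1 @^-1` B) k1 x =
    \int[m2]_(x in A2 `&` X2 @^-1` B) k2 x)%E ->
  forall f : V -> \bar R, measurable_fun setT f -> (forall x, 0 <= f x)%E ->
  (\int[m1]_(x in A1) (f (X1 x) * k1 x) =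
   \int[m2]_(x in A2) (f (X2 x) * k2 x))%E.
Proof.
move=> mA1 mA2 mX1 mX2 mk1 mk2 k10 k20 H f mf f0.
pose f_ := nnsfun_approx measurableT mf.
have E d (T : measurableType d) (m : {measure set T -> \bar R}) (A : set T)
    (X : T -> V) (k : T -> \bar R) : measurable A -> measurable_fun setT X ->
    measurable_fun setT k -> (forall x, 0 <= k x)%E ->
    (\int[m]_(x in A) (f (X x) * k x) =
     limn (fun n => \int[m]_(x in A) ((f_ n (X x))%:E * k x)))%E.
  move=> mA mX mk k0; rewrite -monotone_convergence//.
  - apply: eq_integral => x _; apply/esym/cvg_lim => //.
    have fXx : (f_ n (X x))%:E @[n --> \oo] --> f (X x).
      by apply: cvg_nnsfun_approx => // *; exact: f0.
    (* The product may fail to be continuous when the weight is infinite. There, if [f] vanishes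
       then so do all approximations; if not, they are eventually positive and the product is
       constantly infinite. *)
    have := k0 x; rewrite le_eqVlt => /predU1P[<-|kpos].
      rewrite mule0; under eq_fun do rewrite mule0; exact: cvg_cst.
    have [kfin|] := boolP (k x \is a fin_num).
      by apply: cvgeZr.
    rewrite ge0_fin_numE// -leNgt leye_eq => /eqP ->.
    have := f0 (X x); rewrite le_eqVlt => /predU1P[f0E|fpos].
      rewrite -f0E mul0e.
      have fn0 n : f_ n (X x) = 0.
        apply/eqP; rewrite eq_le fun_ge0 andbT -lee_fin [leRHS]f0E.
        rewrite /f_ nnsfun_approxE; apply: le_approx => // *; exact: f0.
      by under eq_fun do rewrite fn0 mul0e; exact: cvg_cst.
    rewrite gt0_muley//.
    have [n fn] : exists n, 0 < f_ n (X x).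
      apply: contrapT => /forallNP nf; have : f (X x) = 0%E.
        have fn0 n : f_ n (X x) = 0.
          by apply/eqP; rewrite eq_le fun_ge0 andbT leNgt; apply/negP/nf.
        move: fXx; under eq_fun do rewrite fn0.
        by move/cvg_lim => <- //; rewrite lim_cst.
      by move=> fx0; rewrite fx0 ltxx in fpos.
    apply: cvg_near_cst; exists n => // p /= np.
    apply/eqP; rewrite gt0_muley// lte_fin (lt_le_trans fn)//.
    exact/lefP/nd_nnsfun_approx.
  - move=> n; apply: emeasurable_funM; last exact: measurable_funTS.
    apply/measurable_EFinP/measurable_funTS.
    exact: (measurableT_comp _ mX).
  - by move=> n x _; rewrite mule_ge0// lee_fin.
  - move=> x _ p q pq; apply: lee_wpmul2r => //.
    by rewrite lee_fin; exact/lefP/nd_nnsfun_approx.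
rewrite E// E//; congr (limn _); apply/funext => n.
rewrite !weighted_integral_nnsfun//; apply: eq_fsbigr => r _.
by rewrite H//; exact: measurable_sfunP.
Qed.

End Integration.

(** * The Macdonald function *)

(* This and later integrals are sealed because unification would otherwise
   unfold them when comparing two applications. *)
HB.lock Definition macdonald {R : realType} (u y : R) : R :=
  besselK_i u (expR (- y)).

Section Bessel.
Set Implicit Arguments.
Unset Strict Implicit.
Context {R : realType}.
Implicit Types u x y w k : R.
Local Notation mu := (@lebesgue_measure R).

Let besselK_fun u y w : R := expR (- (expR (- y) * cosh w)) * cos (u * w).

Local Open Scope complex_scope.

(** The hyperbolic cosine of the imaginary number [iuw] is [cos (u * w)]. *)
Lemma besselK_iE u x : besselK_i u x =
  \int[mu]_(w in `]0, +oo[) (expR (- (x * cosh w)) * cos (u * w)).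
Proof.
rewrite /besselK_i /besselK /cintegral /=; apply: eq_Rintegral => w _.
rewrite !mul0r !mulr0 !subrr !oppr0 !expR0 !mul1r !add0r cosN.
by field.
Qed.

Local Close Scope complex_scope.

Lemma macdonaldE u y :
  macdonald u y = \int[mu]_(w in `]0, +oo[) besselK_fun u y w.
Proof. by rewrite macdonald.unlock besselK_iE. Qed.

Lemma besselK_i_macdonald u y : besselK_i u (expR (- y)) = macdonald u y.
Proof. by rewrite macdonald.unlock. Qed.

Lemma besselK0_macdonald y : besselK0 (expR (- y)) = macdonald 0 y.
Proof. by rewrite macdonald.unlock. Qed.

(* Uses [expR v >= k + k * v - k * ln k], the tangent of [expR] at [ln k]. *)
Lemma expR_cosh_le k : 0 < k -> exists2 A : R, 0 < A & forall y w,
  expR (- (expR (- y) * cosh w)) <= A * expR (k * y) * expR (- (k * w)).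
Proof.
move=> k0; exists (expR (k * ln 2 - k + k * ln k)); first exact: expR_gt0.
move=> y w; rewrite -!expRD ler_expR.
(* Of [cosh w] only the term [expR w / 2] is kept, which turns the exponent into [expR v]. *)
pose v := w - y - ln 2.
have h1 : expR v <= expR (- y) * cosh w.
  rewrite /v /cosh expRB expRD lnK ?posrE// mulrA ler_pM2r ?invr_gt0//.
  by rewrite [expR w * _]mulrC ler_pM2l ?expR_gt0// lerDl expR_ge0.
have h2 : k * (1 + (v - ln k)) <= expR v.
  have -> : expR v = k * expR (v - ln k).
    by rewrite expRB lnK ?posrE// mulrCA divff ?mulr1// gt_eqF.
  by rewrite ler_pM2l// expR_ge1Dx.
rewrite lerNl; apply: le_trans (le_trans h2 h1).
by rewrite le_eqVlt; apply/orP; left; apply/eqP; rewrite /v; ring.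
Qed.

Lemma measurable_cosh : measurable_fun setT (@cosh R).
Proof.
apply: measurable_funM => //; apply: measurable_funD => //.
by apply: measurableT_comp.
Qed.

Lemma measurable_besselK_fun3 :
  measurable_fun setT (fun z : (R * R) * R => besselK_fun z.1.1 z.1.2 z.2).
Proof.
have mc : measurable_fun setT (@cos R).
  by apply: continuous_measurable_fun; exact: continuous_cos.
apply: measurable_funM.
  apply: measurableT_comp => //; apply: measurableT_comp => //.
  apply: measurable_funM; last exact: (measurableT_comp measurable_cosh).
  by do 2 (apply: measurableT_comp => //); apply: measurableT_comp.
apply: measurableT_comp => //; apply: measurable_funM => //.
exact: (measurableT_comp measurable_fst).
Qed.

Lemma measurable_besselK_fun u y : measurable_fun setT (besselK_fun u y).
Proof.
exact: (measurableT_comp measurable_besselK_fun3 (pair1_measurable (u, y))).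
Qed.

Lemma measurable_macdonald :
  measurable_fun setT (fun z : R * R => macdonald z.1 z.2).
Proof.
under eq_fun do rewrite macdonaldE.
apply: (@measurable_Rintegral _ _ _ _ _ mu _
  (fun z : R * R => besselK_fun z.1 z.2)) => //.
exact: measurable_besselK_fun3.
Qed.

Lemma besselK_fun_le u y w : `|besselK_fun u y w| <= besselK_fun 0 y w.
Proof.
rewrite /besselK_fun normrM ger0_norm ?expR_ge0// mul0r cos0 mulr1.
by rewrite ler_piMr ?expR_ge0 ?cos_max.
Qed.

Lemma besselK_fun0_gt0 y w : 0 < besselK_fun 0 y w.
Proof. by rewrite /besselK_fun mul0r cos0 mulr1 expR_gt0. Qed.

Lemma integrable_besselK_fun u y :
  mu.-integrable `]0, +oo[ (EFin \o besselK_fun u y).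
Proof.
have [A A0 hA] := expR_cosh_le ltr01.
apply: (@le_integrable_EFin R _ _ mu _ _
  (fun w => A * expR (1 * y) * expR (- (1 * w)))) => //.
- apply: measurable_funTS. exact (measurable_besselK_fun u y).
- move=> w _; apply: le_trans (besselK_fun_le u y w) _.
  by rewrite /besselK_fun mul0r cos0 mulr1 hA.
- exact: (integrableZl _ _ (integrable_expRN ltr01)).
Qed.

(** The integrands differ by the factor [cos (u * w)]. This is the source of every later
    domination. *)
Lemma macdonald_le u y : `|macdonald u y| <= macdonald 0 y.
Proof.
rewrite !macdonaldE.
apply: le_trans (le_normr_Rintegral _ (integrable_besselK_fun u y)) _ => //.
apply: le_Rintegral => //.
- exact: (integrable_norm (integrable_besselK_fun u y)).
- exact: integrable_besselK_fun.
- by move=> w _; exact: besselK_fun_le.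
Qed.

Lemma macdonald0_gt0 y : 0 < macdonald 0 y.
Proof.
rewrite macdonaldE; apply: Rintegral_gt0 => //.
- exact: integrable_besselK_fun.
- by move=> w _; exact: besselK_fun0_gt0.
- exact: lebesgue_measure_itvoy_gt0.
Qed.

(** As [k] is arbitrary, a small [k] controls the growth at [+oo] and a large [k] gives fast decay
    at [-oo]. *)
Lemma macdonald0_le_expR k : 0 < k -> exists2 A : R, 0 < A &
  forall y, macdonald 0 y <= A * expR (k * y).
Proof.
move=> k0; have [A A0 hA] := expR_cosh_le k0.
have ik := integrable_expRN k0.
pose I := \int[mu]_(w in `]0, +oo[) expR (- (k * w)).
exists (A * I).
  rewrite mulr_gt0//; apply: Rintegral_gt0 => //.
  - by move=> w _; exact: expR_gt0.
  - exact: lebesgue_measure_itvoy_gt0.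
move=> y; rewrite macdonaldE mulrAC -RintegralZl//.
apply: le_Rintegral => //.
- exact: integrable_besselK_fun.
- exact: (integrableZl _ _ ik).
- by move=> w _; rewrite /besselK_fun mul0r cos0 mulr1 hA.
Qed.

Lemma cosh_gt0 w : 0 < cosh w.
Proof. by rewrite divr_gt0// addr_gt0 ?expR_gt0. Qed.

Lemma besselK_fun0_nondecreasing w : {homo (fun y => besselK_fun 0 y w) : y y' / y <= y'}.
Proof.
move=> y y' yy'; rewrite /besselK_fun !mul0r cos0 !mulr1 ler_expR lerN2.
by rewrite ler_pM2r ?cosh_gt0// ler_expR lerN2.
Qed.

Lemma macdonald0_nondecreasing :
  {homo (fun y => macdonald 0 y) : y y' / y <= y'}.
Proof.
move=> y y' yy'; rewrite !macdonaldE.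
apply: le_Rintegral => //; [exact: integrable_besselK_fun..|].
by move=> w _; exact: besselK_fun0_nondecreasing.
Qed.

(** The factor [cos (u * w)] is common to both integrands, and at [u = 0] their difference has a
    constant sign because the integrand is monotone in [y]. The continuity of [macdonald 0] thus
    controls all indices [u] uniformly. *)
Lemma macdonaldB_le u y y' :
  `|macdonald u y - macdonald u y'| <=
  `|macdonald 0 y - macdonald 0 y'|.
Proof.
wlog yy' : y y' / y' <= y.
  move=> H; case: (leP y' y) => [/H//|/ltW/H h].
  by rewrite distrC [leRHS]distrC; exact: h.
rewrite !macdonaldE -!RintegralB//; try exact: integrable_besselK_fun.
have ib v : mu.-integrable `]0, +oo[
    (EFin \o (fun w => besselK_fun v y w - besselK_fun v y' w)).
  by apply: (integrableB _ (integrable_besselK_fun v y) (integrable_besselK_fun v y')).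
apply: le_trans (le_normr_Rintegral _ (ib u)) _ => //.
apply: le_trans (ler_norm _); apply: le_Rintegral => //.
  exact: (integrable_norm (ib u)).
move=> w _; rewrite /besselK_fun -mulrBl normrM mul0r cos0 !mulr1.
have := besselK_fun0_nondecreasing w yy'; rewrite /besselK_fun !mul0r cos0 !mulr1.
rewrite -subr_ge0 => h; rewrite (ger0_norm h) ler_piMr// cos_max//.
Qed.

(** Monotonicity in [y] makes the integrand at [y + 1] a dominating function on a neighbourhood of
    [y]. *)
Lemma continuous_macdonald0 : continuous (fun y => macdonald 0 y).
Proof.
move=> y; under eq_fun do rewrite macdonaldE.
have yI : y \in `](y - 1), (y + 1)[ by rewrite in_itv/= ltrDl gtrBl ltr01.
apply: (@continuity_under_integral R _ _ mu (fun y w => besselK_fun 0 y w)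
  `]0, +oo[ _ (y - 1) (y + 1) _ _ (besselK_fun 0 (y + 1))) => //.
- by move=> z _; exact: integrable_besselK_fun.
- apply/nearW => w _ z _; rewrite /besselK_fun.
  under eq_fun do rewrite mul0r cos0 mulr1.
  apply: continuous_comp; last exact: continuous_expR.
  apply: (@continuousN _ R^o). apply: (@continuousM _ R^o); last exact: cst_continuous.
  apply: continuous_comp; last exact: continuous_expR.
  exact: (@continuousN _ R^o).
- exact: integrable_besselK_fun.
- move=> z; rewrite /= in_itv/= => /andP[_ /ltW zy]; apply/nearW => w _.
  by rewrite gtr0_norm ?besselK_fun0_gt0//; exact: besselK_fun0_nondecreasing.
- exact/mem_set.
Qed.

Lemma continuous_macdonald y :
  continuous (fun u => macdonald u y).
Proof.
move=> u; under eq_fun do rewrite macdonaldE.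
have uI : u \in `](u - 1), (u + 1)[ by rewrite in_itv/= ltrDl gtrBl ltr01.
apply: (@continuity_under_integral R _ _ mu (fun u w => besselK_fun u y w)
  `]0, +oo[ _ (u - 1) (u + 1) _ _ (besselK_fun 0 y)) => //.
- by move=> z _; exact: integrable_besselK_fun.
- apply/nearW => w _ z _; rewrite /besselK_fun.
  apply: cvgMl_tmp.
  apply: continuous_comp; last exact: continuous_cos.
  by apply: cvgMr_tmp; exact: cvg_id.
- exact: integrable_besselK_fun.
- by move=> z _; apply/nearW => w _; exact: besselK_fun_le.
- exact/mem_set.
Qed.

End Bessel.

(** * Lower bounds for the Gamma function on vertical lines *)

(** The linear form [p * Re + q * Im] of [s^(N + iu) * e^-s]. Keeping [p] and [q] as parameters
    makes the family stable under differentiation in [s], which turns [(p, q)] into [(q, - p)] in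
    the oscillating factor. *)
Definition mellin_fun {R : realType} N (u p q s : R) : R :=
  s ^+ N * expR (- s) * (p * cos (u * ln s) + q * sin (u * ln s)).

(* [mellin N u p q] is [p * Re G + q * Im G] for [G = Gamma(N + 1 + iu)]. *)
HB.lock Definition mellin {R : realType} N (u p q : R) : R :=
  \int[lebesgue_measure]_(s in `]0, +oo[) mellin_fun N u p q s.

Section Mellin.
Set Implicit Arguments.
Unset Strict Implicit.
Context {R : realType}.
Implicit Types u p q s : R.
Local Notation mu := (@lebesgue_measure R).

(** The half-line is exhausted by compact intervals, and dominated convergence with [|f|] passes to
    the limit. *)
Lemma Rintegral_FTC_oo (f F : R -> R) (l0 l1 : R) :
  (forall s, 0 < s -> is_derive s 1 F (f s)) ->
  (forall s, 0 < s -> {for s, continuous f}) ->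
  mu.-integrable `]0, +oo[ (EFin \o f) ->
  F (n.+1%:R^-1) @[n --> \oo] --> l0 -> F n.+1%:R @[n --> \oo] --> l1 ->
  \int[mu]_(s in `]0, +oo[) f s = l1 - l0.
Proof.
move=> dF cf intf F0 F1.
have mf : measurable_fun (`]0, +oo[%classic : set R) f.
  by have /measurable_EFinP := measurable_int mu intf.
(* Starting at [2] keeps the two end points distinct, as the compact case requires. *)
pose I n := `[n.+2%:R^-1, n.+2%:R]%classic : set R.
have I0 n : I n `<=` `]0, +oo[.
  move=> s; rewrite /I/= !in_itv/= andbT => /andP[+ _]; apply: lt_le_trans.
  by rewrite invr_gt0.
have lim1 : \int[mu]_(s in `]0, +oo[) (f \_ (I n)) s @[n --> \oo] -->
    \int[mu]_(s in `]0, +oo[) f s.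
  apply: (@dominated_cvg_Rintegral R _ _ mu _ _ _ (fun s => `|f s|)) => //.
  - by move=> n; apply/measurable_restrict => //; [exact: measurable_itv|exact: (measurable_funS (measurable_itv _) (@subIsetl _ _ _) mf)].
  - move=> s; rewrite /= in_itv/= andbT => s0; apply: cvg_near_cst.
    near=> n; apply/eqP; rewrite patchE mem_set// /I/= in_itv/=; apply/andP; split.
      rewrite invf_ple ?posrE//; near: n.
      exists (Num.truncn s^-1) => // n /= sn.
      by rewrite (le_trans (ltW (truncnS_gt _)))// ler_nat (leq_trans _ (leqnSn _)).
    near: n; exists (Num.truncn s) => // n /= sn.
    by rewrite (le_trans (ltW (truncnS_gt _)))// ler_nat (leq_trans _ (leqnSn _)).
  - exact: integrable_norm.
  - by move=> n s _; rewrite patchE; case: ifP => // _; rewrite normr0.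
have IE n : \int[mu]_(s in `]0, +oo[) (f \_ (I n)) s =
    F n.+2%:R - F n.+2%:R^-1.
  rewrite -Rintegral_mkcondr (setIidr (I0 n)).
  have ab : n.+2%:R^-1 < n.+2%:R :> R.
    by rewrite (@lt_trans _ _ 1)// ?invf_lt1// ltr1n.
  have ip : 0 < n.+2%:R^-1 :> R by rewrite invr_gt0.
  have cF s : 0 < s -> {for s, continuous F}.
    move=> s0; apply/differentiable_continuous/derivable1_diffP.
    by case: (dF _ s0).
  rewrite /Rintegral (@continuous_FTC2 _ f F)//.
  - apply: continuous_in_subspaceT => s /set_mem; rewrite /= in_itv/= => /andP[h _].
    exact: cf (lt_le_trans ip h).
  - split.
    + move=> s; rewrite in_itv/= => /andP[h _].
      by case: (dF _ (lt_trans ip h)).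
    + by apply: cvg_at_right_filter; exact: cF.
    + by apply: cvg_at_left_filter; apply: cF.
  - move=> s; rewrite in_itv/= => /andP[h _].
    by rewrite derive1E; case: (dF _ (lt_trans ip h)).
have lim2 : \int[mu]_(s in `]0, +oo[) (f \_ (I n)) s @[n --> \oo] --> l1 - l0.
  under eq_fun do rewrite IE.
  apply: cvgB; first by rewrite -(cvg_shiftS (fun n => F n.+1%:R)) in F1.
  by rewrite -(cvg_shiftS (fun n => F n.+1%:R^-1)) in F0.
exact: (cvg_unique _ lim1 lim2).
Unshelve. all: end_near. Qed.

Lemma mellinE N u p q : mellin N u p q = \int[mu]_(s in `]0, +oo[) mellin_fun N u p q s.
Proof. by rewrite mellin.unlock. Qed.

Lemma is_derive_mellin_fun N u p q s : 0 < s ->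
  is_derive s 1 (mellin_fun N u p q)
    ((N%:R * s ^+ N.-1 - s ^+ N) * expR (- s) *
       (p * cos (u * ln s) + q * sin (u * ln s)) +
     s ^+ N * expR (- s) * (u / s) * (q * cos (u * ln s) - p * sin (u * ln s))).
Proof.
move=> s0.
have dln := is_derive1_ln s0.
have d1 : is_derive s 1 (fun s => u * ln s) (u / s).
  by apply: is_derive_eq; rewrite /GRing.scale/=; ring.
have dc : is_derive s 1 (fun s => cos (u * ln s)) (- sin (u * ln s) * (u / s)).
  exact: (is_derive1_comp (is_derive_cos _) d1).
have ds : is_derive s 1 (fun s => sin (u * ln s)) (cos (u * ln s) * (u / s)).
  exact: (is_derive1_comp (is_derive_sin _) d1).
have dN : is_derive s 1 (fun s : R => - s) (-1) by apply: is_derive_eq.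
have de : is_derive s 1 (fun s => expR (- s)) (expR (- s) * -1).
  exact: (is_derive1_comp (is_derive_expR _) dN).
have dX : is_derive s 1 (fun s => s ^+ N) (N%:R * s ^+ N.-1).
  have := is_deriveX N (is_derive_id s (1 : R)); rewrite exprfctE /= => h.
  by apply: (is_derive_eq h); rewrite /GRing.scale/= mulr1.
have dM (f g : R -> R) df dg : is_derive s 1 f df -> is_derive s 1 g dg ->
    is_derive s 1 (fun s => f s * g s) (f s * dg + g s * df).
  exact: is_deriveM.
have dD (f g : R -> R) df dg : is_derive s 1 f df -> is_derive s 1 g dg ->
    is_derive s 1 (fun s => f s + g s) (df + dg).
  exact: is_deriveD.
have dC (a : R) : is_derive s 1 (fun=> a) 0 by exact: is_derive_cst.
apply: (is_derive_eq (dM _ _ _ _ (dM _ _ _ _ dX de)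
  (dD _ _ _ _ (dM _ _ _ _ (dC p) dc) (dM _ _ _ _ (dC q) ds)))).
ring.
Qed.

(** One half of the exponent absorbs the power: [x ^ N / N! <= expR x] at [x = s / 2], hence the
    constant [2 ^ N * N!]. *)
Lemma pow_expRN_le N : exists2 A : R, 0 < A &
  forall s, 0 <= s -> s ^+ N * expR (- s) <= A * expR (- (2^-1 * s)).
Proof.
exists (2 ^+ N * N`!%:R); first by rewrite mulr_gt0// ltr0n fact_gt0.
move=> s s0; have -> : expR (- s) = expR (- (2^-1 * s)) * expR (- (2^-1 * s)).
  by rewrite -expRD; congr expR; field.
rewrite mulrA ler_pM2r ?expR_gt0// expRN ler_pdivrMr ?expR_gt0//.
have h0 : 0 <= 2^-1 * s by rewrite mulr_ge0.
suff : (2^-1 * s) ^+ N / N`!%:R <= expR (2^-1 * s).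
  by rewrite ler_pdivrMr ?ltr0n ?fact_gt0// exprMn exprVn mulrC ler_pdivrMr ?exprn_gt0// => /le_trans; apply; rewrite le_eqVlt; apply/orP; left; apply/eqP; ring.
case: N => [|n]; last by apply: le_trans (expR_ge1Dxn n h0); rewrite lerDr.
by rewrite expr0 fact0 divr1 -[leLHS]expR0 ler_expR.
Qed.

Lemma mellin_fun_le N u p q s : 0 < s ->
  `|mellin_fun N u p q s| <= (`|p| + `|q|) * (s ^+ N * expR (- s)).
Proof.
move=> s0; rewrite /mellin_fun normrM [leRHS]mulrC.
rewrite ger0_norm; last by rewrite mulr_ge0 ?expR_ge0 ?exprn_ge0 ?ltW.
rewrite ler_wpM2l//; first by rewrite mulr_ge0 ?expR_ge0 ?exprn_ge0 ?ltW.
by rewrite (le_trans (ler_normD _ _))// lerD// normrM ler_piMr// ?cos_max ?sin_max//.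
Qed.

Lemma measurable_mellin_fun2 N p q :
  measurable_fun setT (fun z : R * R => mellin_fun N z.1 p q z.2).
Proof.
have m1 : measurable_fun setT (fun z : R * R => z.1 * ln z.2).
  apply: measurable_funM => //.
  exact: (measurableT_comp (@measurable_ln R) measurable_snd).
apply: measurable_funM.
  apply: measurable_funM; first exact: measurable_funX.
  by apply: measurableT_comp => //; apply: measurableT_comp.
apply: measurable_funD; apply: measurable_funM => //.
  apply: (measurableT_comp _ m1).
  by apply: continuous_measurable_fun; exact: continuous_cos.
apply: (measurableT_comp _ m1).
by apply: continuous_measurable_fun; exact: continuous_sin.
Qed.

Lemma measurable_mellin_fun N u p q : measurable_fun setT (mellin_fun N u p q).
Proof.
exact: (measurableT_comp (measurable_mellin_fun2 N p q) (pair1_measurable u)).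
Qed.

Lemma measurable_mellin N p q : measurable_fun setT (fun u => mellin N u p q).
Proof.
under eq_fun do rewrite mellinE.
apply: (@measurable_Rintegral _ _ _ _ _ mu _
  (fun u s => mellin_fun N u p q s)) => //.
exact: measurable_mellin_fun2.
Qed.

Lemma integrable_mellin_fun N u p q :
  mu.-integrable `]0, +oo[ (EFin \o mellin_fun N u p q).
Proof.
have [A A0 hA] := pow_expRN_le N.
apply: (@le_integrable_EFin R _ _ mu _ _
  (fun s => (`|p| + `|q|) * A * expR (- (2^-1 * s)))) => //.
- by apply: measurable_funTS; exact: (measurable_mellin_fun N u p q).
- move=> s; rewrite /= in_itv/= andbT => s0.
  apply: le_trans (mellin_fun_le N u p q s0) _.
  by rewrite -mulrA ler_wpM2l ?addr_ge0// hA// ltW.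
- have h2 : 0 < 2^-1 :> R by rewrite invr_gt0.
  exact: (integrableZl _ ((`|p| + `|q|) * A) (integrable_expRN h2)).
Qed.

Lemma mellin_linear N u p q :
  mellin N u p q = p * mellin N u 1 0 + q * mellin N u 0 1.
Proof.
have i1 := integrable_mellin_fun N u 1 0; have i2 := integrable_mellin_fun N u 0 1.
rewrite !mellinE -!RintegralZl// -RintegralD//.
- by apply: eq_Rintegral => s _; rewrite /mellin_fun; ring.
- by apply: integrable_EFinZl.
- by apply: integrable_EFinZl.
Qed.

(** The functional equation [Gamma(z + 1) = z * Gamma(z)] at [z = N + 1 + iu], in real coordinates.
    The function [f] is the derivative of [mellin_fun N.+1 u p q], which vanishes at [0] and at
    [+oo]. *)
Lemma mellinS N u p q :
  mellin N.+1 u p q = N.+1%:R * mellin N u p q + u * mellin N u q (- p).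
Proof.
pose f s := N.+1%:R * mellin_fun N u p q s - mellin_fun N.+1 u p q s +
  u * mellin_fun N u q (- p) s.
have i1 := integrable_mellin_fun N u p q.
have i2 := integrable_mellin_fun N.+1 u p q.
have i3 := integrable_mellin_fun N u q (- p).
have j1 : mu.-integrable `]0, +oo[ (EFin \o (fun s => N.+1%:R * mellin_fun N u p q s)).
  by apply: integrable_EFinZl.
have j3 : mu.-integrable `]0, +oo[ (EFin \o (fun s => u * mellin_fun N u q (- p) s)).
  by apply: integrable_EFinZl.
have j12 : mu.-integrable `]0, +oo[
    (EFin \o (fun s => N.+1%:R * mellin_fun N u p q s - mellin_fun N.+1 u p q s)).
  by apply: integrable_EFinB.
have intf : mu.-integrable `]0, +oo[ (EFin \o f) by apply: integrable_EFinD.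
suff : \int[mu]_(s in `]0, +oo[) f s = 0.
  rewrite /f RintegralD// RintegralB// !RintegralZl// -!mellinE => f0.
  rewrite -[LHS]addr0 -f0; ring.
have [A A0 hA] := pow_expRN_le N.
have [B B0 hB] := pow_expRN_le N.+1.
have M0 : 0 <= `|p| + `|q| by rewrite addr_ge0.
apply: (etrans _ (subrr (0 : R))); apply: (Rintegral_FTC_oo (F := mellin_fun N.+1 u p q)) => //.
- move=> s s0; apply: is_derive_eq (is_derive_mellin_fun N.+1 u p q s0) _.
  rewrite /f /mellin_fun /= exprS; field.
  by rewrite gt_eqF.
- move=> s s0.
  have c K v a b : {for s, continuous (mellin_fun K v a b)}.
    apply/differentiable_continuous/derivable1_diffP.
    by case: (is_derive_mellin_fun K v a b s0).
  apply: cvgD; last by apply: cvgMl_tmp; exact: c.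
  by apply: cvgB; [apply: cvgMl_tmp; exact: c|exact: c].
(* Near [0] a factor [s] is split off the power [s ^ N.+1]; at infinity [expR (- s / 2) <= 2 / s],
   which explains the factor [2] in the second bound. *)
- apply: (@norm_cvg0 _ R^o).
  apply: (@squeeze_cvgr _ _ _ _ (cst 0) (fun n => ((`|p| + `|q|) * A) * n.+1%:R^-1)).
  + apply/nearW => n; rewrite normr_ge0/=.
    have n0 : 0 < n.+1%:R^-1 :> R by rewrite invr_gt0.
    apply: le_trans (mellin_fun_le _ _ _ _ n0) _.
    rewrite -mulrA ler_wpM2l// exprS -mulrA mulrC ler_wpM2r ?(ltW n0)//.
    apply: le_trans (hA _ (ltW n0)) _.
    by rewrite ler_piMr ?ltW// expR_le1 oppr_le0 mulr_ge0 ?ltW.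
  + exact: cvg_cst.
  + by rewrite -(mulr0 ((`|p| + `|q|) * A)); apply: cvgMl_tmp; exact: cvg_harmonic.
- apply: (@norm_cvg0 _ R^o).
  apply: (@squeeze_cvgr _ _ _ _ (cst 0) (fun n => ((`|p| + `|q|) * B * 2) * n.+1%:R^-1)).
  + apply/nearW => n; rewrite normr_ge0/=.
    have n0 : 0 < n.+1%:R :> R by [].
    apply: le_trans (mellin_fun_le _ _ _ _ n0) _.
    rewrite -!mulrA ler_wpM2l//; apply: le_trans (hB _ (ltW n0)) _.
    rewrite ler_pM2l// expRN.
    rewrite -[2 in leRHS]invrK -invfM lef_pV2 ?posrE ?expR_gt0 ?mulr_gt0 ?invr_gt0//.
    by apply: le_trans (expR_ge1Dx _); rewrite lerDr.
  + exact: cvg_cst.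
  + by rewrite -(mulr0 ((`|p| + `|q|) * B * 2)); apply: cvgMl_tmp; exact: cvg_harmonic.
Qed.

End Mellin.

(** * A lower bound for [|Gamma(N + 1 + iu)|] when [N] is large *)

Section MellinModulus.
Set Implicit Arguments.
Unset Strict Implicit.
Context {R : realType}.
Implicit Types u p q s : R.
Local Notation mu := (@lebesgue_measure R).

Lemma sin_le_id (x : R) : 0 <= x -> sin x <= x.
Proof.
rewrite le_eqVlt => /predU1P[<-|x0]; first by rewrite sin0.
have cs : {within `[0, x], continuous (@sin R)}.
  by apply: continuous_subspaceT => z; exact: continuous_sin.
have [c _] := @MVT R sin cos 0 x x0 (fun x _ => is_derive_sin x) cs.
by rewrite sin0 !subr0 => ->; rewrite ler_piMl ?(ltW x0)// cos_le1.
Qed.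

(** The mean value theorem gives [cos x = 1 - x * sin c] with [0 < c < x], and [sin c <= c]. *)
Lemma cos_ge1Bsqr (x : R) : 1 - x ^+ 2 <= cos x.
Proof.
wlog x0 : x / 0 < x.
  move=> H; have [x0|x0|<-] := ltgtP 0 x; first exact: H.
    by rewrite -cosN -sqrrN H// oppr_gt0.
  by rewrite cos0 expr0n subr0.
have cc : {within `[0, x], continuous (@cos R)}.
  by apply: continuous_subspaceT => z; exact: continuous_cos.
have [c] := @MVT R cos (fun x => - sin x) 0 x x0 (fun x _ => is_derive_cos x) cc.
rewrite in_itv/= => /andP[c0 cx]; rewrite cos0 subr0 => /eqP; rewrite subr_eq => /eqP ->.
rewrite mulNr [leRHS]addrC lerD2l lerN2 expr2 ler_pM2r//.
by rewrite (le_trans (sin_le_id (ltW c0)))// ltW.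
Qed.

(** With [r = expR (2 * v)] this is the square of [|v| <= |expR v - expR (- v)|]. It replaces a
    logarithm by powers of [r], whose integrals against [s ^ N * expR (- s)] are factorials up to a
    constant. *)
Lemma sqr_ln_le (r : R) : 0 < r -> ln r ^+ 2 <= 4 * (r - 2 + r^-1).
Proof.
move=> r0; pose v := ln r / 2.
have -> : ln r = 2 * v by rewrite /v; field.
have rE : r = expR v ^+ 2.
  by rewrite -expRM_natl /v mulrCA divff// mulr1 lnK.
have -> : r - 2 + r^-1 = (expR v - expR (- v)) ^+ 2.
  by rewrite rE expRN; field; rewrite gt_eqF ?expR_gt0.
rewrite exprMn (_ : 2 ^+ 2 = 4 :> R); last by rewrite expr2 -natrM.
rewrite ler_pM2l//; wlog v0 : v {rE} / 0 <= v.
  move=> H; have [/H//|/ltW v0] := leP 0 v.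
  have := H (- v); rewrite oppr_ge0 opprK sqrrN => /(_ v0).
  by rewrite -[in leRHS]opprB sqrrN.
rewrite ler_sqr ?nnegrE//; last first.
  by rewrite subr_ge0 ler_expR (le_trans _ v0)// oppr_le0.
rewrite lerBrDr (le_trans _ (expR_ge1Dx v))// addrC lerD2r.
by rewrite expR_le1 oppr_le0.
Qed.

Let a N : R := mellin N 0 1 0.

Lemma mellin0S N : a N.+1 = N.+1%:R * a N.
Proof. by rewrite /a mellinS mul0r addr0. Qed.

Lemma mellin0_gt0 N : 0 < a N.
Proof.
rewrite /a mellinE; apply: Rintegral_gt0 => //; [exact: (@integrable_mellin_fun R N 0 1 0)| |exact: lebesgue_measure_itvoy_gt0].
move=> s; rewrite /= in_itv/= andbT => s0.
by rewrite /mellin_fun mul0r cos0 sin0 mulr0 addr0 !mulr1 mulr_gt0 ?exprn_gt0 ?expR_gt0.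
Qed.

Lemma mellin0_fact N : a N = N`!%:R * a 0.
Proof.
elim: N => [|N IH]; first by rewrite fact0 mul1r.
by rewrite mellin0S IH factS natrM mulrA.
Qed.

(** The squared modulus of [Gamma(N + 1 + iu)]. *)
Definition mellin_sqr N u : R := mellin N u 1 0 ^+ 2 + mellin N u 0 1 ^+ 2.

Lemma mellin_sqrS N u :
  mellin_sqr N.+1 u = (N.+1%:R ^+ 2 + u ^+ 2) * mellin_sqr N u.
Proof.
rewrite /mellin_sqr !mellinS (mellin_linear N u 0 (-1)) (mellin_linear N u 1 (- 0)).
ring.
Qed.

Lemma mellin_sqr_prod N u : mellin_sqr N u =
  mellin_sqr 0 u * N`!%:R ^+ 2 * \prod_(k < N) (1 + u ^+ 2 / k.+1%:R ^+ 2).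
Proof.
elim: N => [|N IH]; first by rewrite big_ord0 fact0 expr1n !mulr1.
rewrite mellin_sqrS IH big_ord_recr/= factS natrM; field.
by rewrite ?natr1 ?nat1r pnatr_eq0.
Qed.

(** The phase is aligned with its value at [s = N]: for [p + iq = N^(iu)], [mellin N u p q] is the
    integral of [s ^ N * expR (- s) * cos (u * ln (s / N))] and is at most the modulus. With
    [r = s / N] the cosine is at least [1 - 4 * u ^ 2 * (r - 2 + 1 / r)]. The means of [r] and
    [1 / r] under the normalised weight are [1 + 1 / N] and [1], so the integral is at least
    [a N * (1 - 4 * u ^ 2 / N) >= a N / 2]. *)
Lemma mellin_sqr_ge N u : (0 < N)%N -> 8 * u ^+ 2 <= N%:R ->
  (a N / 2) ^+ 2 <= mellin_sqr N u.
Proof.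
move=> N0 uN; have N0' : 0 < N%:R :> R by rewrite ltr0n.
pose p := cos (u * ln N%:R); pose q := sin (u * ln N%:R).
have pq1 : p ^+ 2 + q ^+ 2 = 1 by rewrite cos2Dsin2.
suff h : a N / 2 <= p * mellin N u 1 0 + q * mellin N u 0 1.
  apply: (@le_trans _ _ ((p * mellin N u 1 0 + q * mellin N u 0 1) ^+ 2)).
    rewrite ler_sqr ?nnegrE//; first by rewrite divr_ge0// ltW// mellin0_gt0.
    by apply: le_trans h; rewrite divr_ge0// ltW// mellin0_gt0.
  have -> : mellin_sqr N u = (p ^+ 2 + q ^+ 2) * mellin_sqr N u by rewrite pq1 mul1r.
  rewrite /mellin_sqr -subr_ge0.
  set x := mellin _ _ _ _; set y := mellin _ _ _ _.
  (* Lagrange's identity, that is, the Cauchy-Schwarz inequality in the plane. *)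
  rewrite (_ : _ - _ = (p * y - q * x) ^+ 2); first exact: sqr_ge0.
  ring.
rewrite -mellin_linear.
case: N N0 uN N0' @p @q pq1 => // N _ uN N0' p q pq1.
have i0 := @integrable_mellin_fun R N.+1 0 1 0.
have ip := @integrable_mellin_fun R N.+2 0 1 0.
have im := @integrable_mellin_fun R N 0 1 0.
pose c : R := 4 * u ^+ 2.
(* The lower bound [s ^ N.+1 * expR (- s) * (1 - c * (r - 2 + 1 / r))] with [r = s / N.+1], expanded
   so that each term is a moment integrand. *)
pose f s := (1 + 2 * c) * mellin_fun N.+1 0 1 0 s - c / N.+1%:R * mellin_fun N.+2 0 1 0 s -
  c * N.+1%:R * mellin_fun N 0 1 0 s.
have j1 : mu.-integrable `]0, +oo[ (EFin \o (fun s => (1 + 2 * c) * mellin_fun N.+1 0 1 0 s)).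
  by apply: integrable_EFinZl.
have j2 : mu.-integrable `]0, +oo[ (EFin \o (fun s => c / N.+1%:R * mellin_fun N.+2 0 1 0 s)).
  by apply: integrable_EFinZl.
have j3 : mu.-integrable `]0, +oo[ (EFin \o (fun s => c * N.+1%:R * mellin_fun N 0 1 0 s)).
  by apply: integrable_EFinZl.
have j12 : mu.-integrable `]0, +oo[ (EFin \o (fun s =>
    (1 + 2 * c) * mellin_fun N.+1 0 1 0 s - c / N.+1%:R * mellin_fun N.+2 0 1 0 s)).
  by apply: integrable_EFinB.
have intf : mu.-integrable `]0, +oo[ (EFin \o f) by apply: integrable_EFinB.
have If : \int[mu]_(s in `]0, +oo[) f s = a N.+1 * (1 - c / N.+1%:R).
  rewrite /f RintegralB// RintegralB// !RintegralZl// -!mellinE -!/(a _).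
  rewrite !mellin0S -[N.+2%:R]natr1; field.
  by rewrite ?natr1 ?nat1r pnatr_eq0.
apply: (@le_trans _ _ (\int[mu]_(s in `]0, +oo[) f s)).
  rewrite If ler_pM2l ?mellin0_gt0// lerBrDr addrC -lerBrDr.
  rewrite ler_pdivrMr// (le_trans _ (_ : 2^-1 * (8 * u ^+ 2) <= _))//.
  - by rewrite le_eqVlt; apply/orP; left; apply/eqP; rewrite /c; field.
  - rewrite (_ : 1 - 2^-1 = 2^-1 :> R); last by field.
    by rewrite ler_pM2l.
rewrite mellinE; apply: le_Rintegral => //; first exact: (integrable_mellin_fun N.+1 u p q).
move=> s; rewrite /= in_itv/= andbT => s0.
rewrite /f /mellin_fun mul0r cos0 sin0 mulr0 addr0 !mulr1.
rewrite /p /q -(mulrC (cos (u * ln s))) -(mulrC (sin (u * ln s))) -cosB -mulrBr.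
pose r := s / N.+1%:R.
have r0 : 0 < r by rewrite divr_gt0.
have -> : ln s - ln N.+1%:R = ln r by rewrite ln_div.
apply: (@le_trans _ _ (s ^+ N.+1 * expR (- s) * (1 - c * (r - 2 + r^-1)))).
  rewrite le_eqVlt; apply/orP; left; apply/eqP; rewrite /r !exprS; field.
  by rewrite ?natr1 ?nat1r pnatr_eq0/= gt_eqF.
rewrite ler_pM2l ?mulr_gt0 ?exprn_gt0 ?expR_gt0//.
apply: le_trans (cos_ge1Bsqr _); rewrite lerD2l lerN2 exprMn.
rewrite (_ : c * _ = u ^+ 2 * (4 * (r - 2 + r^-1))); last by rewrite /c; ring.
by rewrite ler_wpM2l ?sqr_ge0// sqr_ln_le.
Qed.

End MellinModulus.

(** * Descent from [|Gamma(N + 1 + iu)|] to [|Gamma(iu)|] *)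

Section GammaWeight.
Set Implicit Arguments.
Unset Strict Implicit.
Context {R : realType}.
Implicit Types u p q s : R.
Local Notation mu := (@lebesgue_measure R).

(** The first [M] factors are at most [1 + u ^ 2]. The others are bounded by exponentials, whose
    exponents telescope because [1 / (n + 1) ^ 2 <= 1 / n - 1 / (n + 1)]. The exponential rate is
    below [1 / M], at the price of a polynomial. *)
Lemma prod_1Dsqr_le u M j : (0 < M)%N ->
  \prod_(k < M + j) (1 + u ^+ 2 / k.+1%:R ^+ 2) <=
  (1 + u ^+ 2) ^+ M * expR (u ^+ 2 * (M%:R^-1 - (M + j)%:R^-1)).
Proof.
move=> M0; have t_ge0 k : 0 <= 1 + u ^+ 2 / k.+1%:R ^+ 2.
  by rewrite addr_ge0// divr_ge0 ?sqr_ge0.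
elim: j => [|j IH].
  rewrite addn0 subrr mulr0 expR0 mulr1 -[in leRHS](card_ord M) -prodr_const.
  apply: ler_prod => k _; rewrite t_ge0/= lerD2l ler_piMr ?sqr_ge0//.
  by rewrite invf_le1 ?exprn_gt0// exprn_ege1// ler1n.
rewrite addnS big_ord_recr/=.
have n0 : 0 < (M + j)%:R :> R by rewrite ltr0n addn_gt0 M0.
move: (M + j)%N n0 IH => n n0 IH.
have key : 1 + u ^+ 2 / n.+1%:R ^+ 2 <= expR (u ^+ 2 * (n%:R^-1 - n.+1%:R^-1)).
  apply: le_trans (expR_ge1Dx _); rewrite lerD2l ler_wpM2l ?sqr_ge0//.
  have -> : n%:R^-1 - n.+1%:R^-1 = (n%:R * n.+1%:R)^-1 :> R.
    have nS : n%:R + 1 != 0 :> R by rewrite natr1 pnatr_eq0.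
    by rewrite -natr1; field; rewrite nS gt_eqF.
  rewrite lef_pV2 ?posrE ?mulr_gt0 ?exprn_gt0// expr2 ler_pM2r//.
  by rewrite ler_nat.
have P0 : 0 <= \prod_(k < n) (1 + u ^+ 2 / k.+1%:R ^+ 2) by apply: prodr_ge0.
apply: le_trans (ler_pM P0 (t_ge0 _) IH key) _.
by rewrite -mulrA -expRD -mulrDr addrA subrK.
Qed.

(** The lower bound at a large [N], divided by the factors of the functional equation. The constant
    does not depend on [N], which varies with [u]. *)
Lemma mellin_sqr_inv_le (e : R) : 0 < e -> exists2 C : R, 0 < C &
  forall u, 0 < mellin_sqr 0 u /\ (mellin_sqr 0 u)^-1 <= C * expR (e * u ^+ 2).
Proof.
move=> e0; pose M := (Num.truncn (2 / e)).+1.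
have M0 : 0 < M%:R :> R by rewrite ltr0n.
have Me : M%:R^-1 <= e / 2.
  rewrite -[leRHS]invrK lef_pV2 ?posrE ?invr_gt0 ?divr_gt0// invf_div.
  exact: (ltW (truncnS_gt _)).
pose de := Num.min 1 (e / (2 * M%:R)).
have de0 : 0 < de by rewrite lt_min ltr01 divr_gt0// mulr_gt0.
pose a0 := @mellin R 0 0 1 0.
have a00 : 0 < a0 by exact: mellin0_gt0.
exists (4 / a0 ^+ 2 * de^-1 ^+ M); first by rewrite mulr_gt0 ?divr_gt0 ?exprn_gt0 ?invr_gt0.
(* Large enough both for splitting the product at [M] and for [mellin_sqr_ge]. *)
move=> u; pose N := (M + (Num.truncn (8 * u ^+ 2)).+1)%N.
have N0 : (0 < N)%N by rewrite addn_gt0.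
have uN : 8 * u ^+ 2 <= N%:R.
  by rewrite (le_trans (ltW (truncnS_gt _)))// ler_nat leq_addl.
have := mellin_sqr_ge N0 uN; rewrite mellin0_fact -/a0 mellin_sqr_prod => h.
have f0 : 0 < N`!%:R ^+ 2 :> R by rewrite exprn_gt0// ltr0n fact_gt0.
pose Q := \prod_(k < N) (1 + u ^+ 2 / k.+1%:R ^+ 2).
have {h} h : a0 ^+ 2 / 4 <= mellin_sqr 0 u * Q.
  rewrite -(ler_pM2r f0) [leRHS]mulrAC; apply: le_trans h.
  by rewrite le_eqVlt; apply/orP; left; apply/eqP; field.
have Q0 : 0 < Q.
  by apply: prodr_gt0 => k _; rewrite ltr_pwDl// divr_ge0 ?sqr_ge0.
have m0 : 0 < mellin_sqr 0 u.
  by rewrite -(pmulr_lgt0 _ Q0); apply: lt_le_trans h; rewrite divr_gt0 ?exprn_gt0.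
split=> //.
have hQ : Q <= de^-1 ^+ M * expR (e * u ^+ 2).
  apply: le_trans (prod_1Dsqr_le u _ (isT : 0 < M)%N) _.
  have h1 : 1 + u ^+ 2 <= de^-1 * expR (de * u ^+ 2).
    rewrite -ler_pdivrMl ?invr_gt0// invrK; apply: le_trans (expR_ge1Dx _).
    by rewrite mulrDr lerD2r mulr1 ge_min lexx.
  apply: (@le_trans _ _ ((de^-1 * expR (de * u ^+ 2)) ^+ M * expR (u ^+ 2 * (e / 2)))).
    apply: ler_pM; rewrite ?exprn_ge0 ?expR_ge0 ?addr_ge0 ?sqr_ge0//.
      by rewrite lerXn2r ?nnegrE ?addr_ge0 ?sqr_ge0// (le_trans _ h1) ?addr_ge0 ?sqr_ge0.
    rewrite ler_expR ler_wpM2l ?sqr_ge0// (le_trans _ Me)// lerBlDr lerDl.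
    by rewrite invr_ge0.
  rewrite exprMn -mulrA ler_pM2l ?exprn_gt0 ?invr_gt0// -expRM_natl -expRD ler_expR.
  rewrite -[leRHS]mulrC (_ : _ + _ = u ^+ 2 * (M%:R * de + e / 2)); last by ring.
  rewrite ler_wpM2l ?sqr_ge0// [leRHS](splitr e) lerD2r.
  by rewrite -ler_pdivlMl// ge_min orbC (_ : M%:R^-1 * (e / 2) = e / (2 * M%:R)) ?lexx//; field; rewrite gt_eqF.
rewrite -(mulrA (4 / _)); apply: (@le_trans _ _ (4 / a0 ^+ 2 * Q)); last first.
  by rewrite ler_pM2l// divr_gt0 ?exprn_gt0.
rewrite -ler_pdivrMl ?divr_gt0 ?exprn_gt0// invf_div mulrC.
by rewrite ler_pdivrMl.
Qed.

Local Open Scope complex_scope.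

(** The definition of [Gamma] shifts once at [iu], so that [Gamma(iu) = Gamma(1 + iu) / (iu)]. *)
Lemma normc_Gamma_sqr u : 0 < u ->
  ComplexField.Normc.normc (Gamma (0 +i* u)) ^+ 2 = mellin_sqr 0 u / u ^+ 2.
Proof.
move=> u0; rewrite /Gamma.
have -> : Num.truncn (1 - complex.Re (0 +i* u)) = 1%N by rewrite subr0 truncn1.
rewrite big_ord1 addr0.
have -> : euler_integral (0 +i* u + 1%:R) = mellin 0 u 1 0 +i* mellin 0 u 0 1.
  rewrite /euler_integral /cintegral !mellinE; congr (_ +i* _); apply: eq_Rintegral => s _;
  rewrite /mellin_fun /= !(mul0r, mulr0, mul1r, mulr1, add0r, addr0, subr0, subrr, expR0, oppr0, expr0).
  by rewrite mulrC.
  by rewrite mulrC.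
have z0 : (0 +i* u) != 0 :> R[i] by rewrite eq_complex/= eqxx/= gt_eqF.
have nE (x y : R) : ComplexField.Normc.normc (x +i* y) ^+ 2 = x ^+ 2 + y ^+ 2.
  by rewrite /= sqr_sqrtr// addr_ge0 ?sqr_ge0.
have := divfK z0 (mellin 0 u 1 0 +i* mellin 0 u 0 1).
move=> /(congr1 (fun z => ComplexField.Normc.normc z ^+ 2)).
rewrite ComplexField.Normc.normcM exprMn !nE expr0n/= add0r /mellin_sqr => <-.
by rewrite mulfK// expf_neq0// gt_eqF.
Qed.

Local Close Scope complex_scope.

End GammaWeight.

(** * The heat kernel *)

(* The factor [u ^+ 2 / mellin_sqr 0 u] is [1 / |Gamma(iu)|^2] for [u > 0]. *)
Definition spectral_weight {R : realType} (t u : R) : R :=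
  expR (- (t * u ^+ 2 / 4)) * (u ^+ 2 / mellin_sqr 0 u).

(** The factor [2 / pi] is included, so that [heat t x y / kernel_mass t] tends to [K 0 x * K 0 y]
    exactly. *)
HB.lock Definition kernel_mass {R : realType} (t : R) : R :=
  2 / pi * \int[lebesgue_measure]_(u in `]0, +oo[) spectral_weight t u.

HB.lock Definition heat {R : realType} (t x y : R) : R :=
  2 / pi * \int[lebesgue_measure]_(u in `]0, +oo[)
    (spectral_weight t u * (macdonald u x * macdonald u y)).

Section HeatKernel.
Set Implicit Arguments.
Unset Strict Implicit.
Context {R : realType}.
Implicit Types t u x y : R.
Local Notation mu := (@lebesgue_measure R).
Local Notation K := macdonald.
Local Notation K0 := (macdonald 0).

Lemma mellin_sqr_gt0 u : 0 < mellin_sqr 0 u.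
Proof. by have [C _ /(_ u)[]] := @mellin_sqr_inv_le R 1 ltr01. Qed.

Lemma spectral_weight_gt0 t u : 0 < u -> 0 < spectral_weight t u.
Proof.
by move=> u0; rewrite mulr_gt0 ?expR_gt0// divr_gt0 ?exprn_gt0 ?mellin_sqr_gt0.
Qed.

Lemma spectral_weight_ge0 t u : 0 <= spectral_weight t u.
Proof. by rewrite mulr_ge0 ?expR_ge0// divr_ge0 ?sqr_ge0 ?(ltW (mellin_sqr_gt0 _)). Qed.

Lemma heatE t x y : heat t x y =
  2 / pi * \int[mu]_(u in `]0, +oo[) (spectral_weight t u * (K u x * K u y)).
Proof. by rewrite heat.unlock. Qed.

Lemma kernel_massE t : kernel_mass t =
  2 / pi * \int[mu]_(u in `]0, +oo[) spectral_weight t u.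
Proof. by rewrite kernel_mass.unlock. Qed.

Lemma heat_kernelE t x y : heat_kernel t x y = heat t x y.
Proof.
rewrite heatE; congr (_ * _); apply: eq_Rintegral => u; rewrite inE/= in_itv/= andbT => u0.
rewrite normc_Gamma_sqr// /spectral_weight invf_div !besselK_i_macdonald.
ring.
Qed.

Lemma measurable_spectral_weight t : measurable_fun setT (spectral_weight t).
Proof.
have mX : measurable_fun setT (fun u : R => u ^+ 2) by exact: measurable_funX.
apply: measurable_funM.
  apply: measurableT_comp => //; apply: measurableT_comp => //.
  by apply: measurable_funM => //; exact: measurable_funM.
apply: measurable_funM => //; apply: measurable_funV_gt0; first exact: mellin_sqr_gt0.
by apply: measurable_funD; apply: measurable_funX; exact: measurable_mellin.
Qed.

Lemma integrable_spectral_weight t : 0 < t ->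
  mu.-integrable `]0, +oo[ (EFin \o spectral_weight t).
Proof.
(* The factors [u ^ 2] and [1 / mellin_sqr 0 u] each cost [expR (t / 16 * u ^ 2)] out of the
   Gaussian. What remains, [expR (- t * u ^ 2 / 8)], is at most [expR (2 / t) * expR (- u)] by
   completing the square. *)
move=> t0; have t16 : 0 < t / 16 by rewrite divr_gt0.
have [C C0 hC] := mellin_sqr_inv_le t16.
apply: (@le_integrable_EFin R _ _ mu _ _
  (fun u => C * (16 / t) * expR (2 / t) * expR (- (1 * u)))) => //.
- by apply: measurable_funTS; exact: (measurable_spectral_weight t).
- move=> u _; rewrite ger0_norm ?spectral_weight_ge0// /spectral_weight.
  have h1 : u ^+ 2 <= (16 / t) * expR (t / 16 * u ^+ 2).
    rewrite -invf_div -ler_pdivrMl ?invr_gt0// invrK.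
    by apply: le_trans (expR_ge1Dx _); rewrite lerDr.
  have h2 : u ^+ 2 / mellin_sqr 0 u <=
      (16 / t) * expR (t / 16 * u ^+ 2) * (C * expR (t / 16 * u ^+ 2)).
    apply: ler_pM => //; rewrite ?sqr_ge0 ?invr_ge0 ?(ltW (mellin_sqr_gt0 _))//.
    by have [] := hC u.
  apply: (le_trans (ler_wpM2l (expR_ge0 _) h2)).
  rewrite [leLHS](_ : _ = C * (16 / t) * (expR (- (t * u ^+ 2 / 4)) *
     (expR (t / 16 * u ^+ 2) * expR (t / 16 * u ^+ 2)))); last by ring.
  rewrite -(mulrA (C * _)) ler_pM2l ?mulr_gt0 ?invr_gt0// -!expRD ler_expR.
  rewrite -subr_ge0 (_ : _ - _ = t / 8 * (u - 4 / t) ^+ 2).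
    by rewrite mulr_ge0 ?sqr_ge0// ltW// divr_gt0.
  by field; rewrite gt_eqF.
- apply: integrable_EFinZl => //; exact: (integrable_expRN ltr01).
Qed.

Lemma kernel_mass_gt0 t : 0 < t -> 0 < kernel_mass t.
Proof.
move=> t0; rewrite kernel_massE mulr_gt0 ?divr_gt0 ?pi_gt0//; apply: Rintegral_gt0 => //.
- exact: integrable_spectral_weight.
- by move=> u; rewrite /= in_itv/= andbT; exact: spectral_weight_gt0.
- exact: lebesgue_measure_itvoy_gt0.
Qed.

Lemma measurable_macdonald_index y : measurable_fun setT (fun u => K u y).
Proof. exact: (measurableT_comp (@measurable_macdonald R) (pair2_measurable y)). Qed.

Lemma integrable_spectral_bounded t (f : R -> R) (B : R) : 0 < t ->
  measurable_fun setT f -> (forall u, 0 < u -> `|f u| <= B) ->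
  mu.-integrable `]0, +oo[ (EFin \o (fun u => spectral_weight t u * f u)).
Proof.
move=> t0 mf fB.
apply: (@le_integrable_EFin R _ _ mu _ _ (fun u => B * spectral_weight t u)) => //.
- apply: measurable_funTS; apply: measurable_funM => //.
  exact: measurable_spectral_weight.
- move=> u; rewrite /= in_itv/= andbT => u0.
  by rewrite normrM mulrC (ger0_norm (spectral_weight_ge0 _ _)) ler_wpM2r ?spectral_weight_ge0 ?fB.
- by apply: integrable_EFinZl => //; exact: integrable_spectral_weight.
Qed.

Lemma spectral_bounded_le t (f : R -> R) (B : R) : 0 < t ->
  measurable_fun setT f -> (forall u, 0 < u -> `|f u| <= B) ->
  `|2 / pi * \int[mu]_(u in `]0, +oo[) (spectral_weight t u * f u)| <= kernel_mass t * B.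
Proof.
move=> t0 mf fB; have fint := integrable_spectral_bounded t0 mf fB.
have wint := integrable_spectral_weight t0.
have c0 : 0 <= 2 / pi :> R by rewrite divr_ge0 ?pi_ge0.
rewrite normrM (ger0_norm c0) kernel_massE -(mulrA (2 / pi)) ler_wpM2l//.
apply: le_trans (le_normr_Rintegral _ fint) _ => //.
rewrite -RintegralZr//; apply: le_Rintegral => //.
- exact: integrable_norm.
- apply: eq_integrable (@integrable_EFinZl R _ _ mu _ _ B _ wint) => // u _.
  by rewrite /= mulrC.
- move=> u; rewrite /= in_itv/= andbT => u0.
  by rewrite normrM (ger0_norm (spectral_weight_ge0 _ _)) ler_wpM2l ?spectral_weight_ge0 ?fB.
Qed.

Lemma macdonald0_ge0 y : 0 <= K0 y.
Proof. exact/ltW/macdonald0_gt0. Qed.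

Lemma measurable_macdonald_prod x y : measurable_fun setT (fun u => K u x * K u y).
Proof. by apply: measurable_funM; exact: measurable_macdonald_index. Qed.

Lemma macdonald_prod_le x y u : `|K u x * K u y| <= K0 x * K0 y.
Proof. by rewrite normrM ler_pM ?macdonald_le. Qed.

Lemma heat_le t x y : 0 < t ->
  `|heat t x y| <= kernel_mass t * (K0 x * K0 y).
Proof.
move=> t0; rewrite heatE; apply: spectral_bounded_le => //.
- exact: measurable_macdonald_prod.
- by move=> u _; exact: macdonald_prod_le.
Qed.

Lemma measurable_heat t :
  measurable_fun setT (fun z : R * R => heat t z.1 z.2).
Proof.
under eq_fun do rewrite heatE.
apply: measurable_funM => //.
apply: (@measurable_Rintegral R _ _ _ _ mu _
  (fun (z : R * R) u => spectral_weight t u * (K u z.1 * K u z.2))) => //.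
apply: measurable_funM.
  exact: (measurableT_comp (measurable_spectral_weight t) measurable_snd).
apply: measurable_funM.
- apply: (measurableT_comp (@measurable_macdonald R)
    (g := fun w : (R * R) * R => (w.2, w.1.1))).
  apply: measurable_fun_pair => //.
  exact: (measurableT_comp measurable_fst measurable_fst).
- apply: (measurableT_comp (@measurable_macdonald R)
    (g := fun w : (R * R) * R => (w.2, w.1.2))).
  apply: measurable_fun_pair => //.
  exact: (measurableT_comp measurable_snd measurable_fst).
Qed.

(** The difference of products under the integral is split in two, and [macdonaldB_le] bounds each
    part independently of [u]. The continuity of [macdonald 0] thus gives that of [heat t]. *)
Lemma heatB_le t x y x' y' : 0 < t ->
  `|heat t x y - heat t x' y'| <=
  kernel_mass t * (`|K0 x - K0 x'| * K0 y + K0 x' * `|K0 y - K0 y'|).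
Proof.
move=> t0; have i z w : mu.-integrable `]0, +oo[
    (EFin \o (fun u => spectral_weight t u * (K u z * K u w))).
  apply: (@integrable_spectral_bounded _ _ (K0 z * K0 w)) => //.
  - exact: measurable_macdonald_prod.
  - by move=> u _; exact: macdonald_prod_le.
rewrite !heatE -mulrBr -RintegralB//.
under eq_Rintegral do rewrite -mulrBr.
apply: spectral_bounded_le => //.
  by apply: measurable_funB; exact: measurable_macdonald_prod.
have alg (a b c d : R) : a * b - c * d = (a - c) * b + c * (b - d) by ring.
move=> u _; rewrite alg; apply: (le_trans (ler_normD _ _)).
by rewrite !normrM lerD// ler_pM// ?macdonaldB_le ?macdonald_le.
Qed.

Lemma heat_lt0_near t x0 y0 : 0 < t -> heat t x0 y0 < 0 ->
  exists2 e : R, 0 < e & exists2 d : R, 0 < d & forall x y, `|x - x0| < d -> `|y - y0| < d ->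
    heat t x y <= - e.
Proof.
move=> t0 p0; pose e := - heat t x0 y0 / 2.
have e0 : 0 < e by rewrite divr_gt0// oppr_gt0.
exists e => //.
(* The bound of [heatB_le] involves [K0 y] at the moving point, which is at most [K0 y0 + 1] nearby.
   Variations below [e / M] then change [heat] by at most [e], half of its distance to [0]. *)
pose M := kernel_mass t * (K0 y0 + 1 + K0 x0).
have M0 : 0 < M.
  by rewrite mulr_gt0 ?kernel_mass_gt0// !addr_gt0 ?macdonald0_gt0.
have m0 : 0 < Num.min 1 (e / M) by rewrite lt_min ltr01 divr_gt0.
have cz z : \forall w \near z, `|K0 z - K0 w| < Num.min 1 (e / M).
  by have /cvgr_dist_lt := @continuous_macdonald0 R z; exact.
have [d1 /= d10 hx] := cz x0; have [d2 /= d20 hy] := cz y0.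
exists (Num.min d1 d2); first by rewrite lt_min d10.
move=> x y; rewrite !lt_min => /andP[xd1 _] /andP[_ yd2].
have {}hx : `|K0 x0 - K0 x| < Num.min 1 (e / M) by apply: hx; rewrite /ball_/= distrC.
have {}hy : `|K0 y0 - K0 y| < Num.min 1 (e / M) by apply: hy; rewrite /ball_/= distrC.
have hD := @heatB_le t x y x0 y0 t0.
have m1 : Num.min 1 (e / M) <= 1 by rewrite ge_min lexx.
have m2 : Num.min 1 (e / M) <= e / M by rewrite ge_min lexx orbT.
have hy1 := lt_le_trans hy m1.
have {}hx := lt_le_trans hx m2; have {}hy := lt_le_trans hy m2.
have y1 : K0 y <= K0 y0 + 1.
  by rewrite -lerBlDl (le_trans (ler_norm _))// distrC ltW.
have {hD}hD : `|heat t x y - heat t x0 y0| <= e.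
  have eM : e = e / M * M by rewrite divfK// gt_eqF.
  move: (e / M) eM hx hy {m0 cz m1 m2 hy1 d1 d10 d2 d20 xd1 yd2} => q eM hx hy.
  apply: le_trans hD _; rewrite eM /M mulrCA ler_pM2l ?kernel_mass_gt0// mulrDr.
  apply: lerD.
    by apply: ler_pM; rewrite ?macdonald0_ge0// distrC ltW.
  by rewrite mulrC; apply: ler_pM; rewrite ?macdonald0_ge0// distrC ltW.
have := le_trans (ler_norm _) hD; rewrite lerBlDr => h; apply: le_trans h _.
by rewrite /e le_eqVlt; apply/orP; left; apply/eqP; field.
Qed.

End HeatKernel.

(** * Large-time asymptotics *)

Section Asymptotics.
Set Implicit Arguments.
Unset Strict Implicit.
Context {R : realType}.
Implicit Types t u x y : R.
Local Notation mu := (@lebesgue_measure R).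
Local Notation K := macdonald.
Local Notation K0 := (macdonald 0).

(** Laplace's method. Beyond [d] the weight is at most [expR (- (t - 1) * d ^ 2 / 4)] times the
    weight at time [1], whereas the interval from [0] to [d / 2] alone contributes at least
    [expR (- (t - 1) * (d / 2) ^ 2 / 4) * m0] to the total mass. The far part is therefore
    exponentially negligible. *)
Lemma spectral_concentration (f : R -> R) (B L : R) :
  measurable_fun setT f -> (forall u, 0 < u -> `|f u| <= B) ->
  f u @[u --> 0^'+] --> L ->
  2 / pi * (\int[mu]_(u in `]0, +oo[) (spectral_weight t u * f u)) / kernel_mass t
    @[t --> +oo] --> L.
Proof.
move=> mf fB fL.
have c0 : 0 < 2 / pi :> R by rewrite divr_gt0 ?pi_gt0.
apply/cvgrPdist_le => e e0.
have e20 : 0 < e / 2 by rewrite divr_gt0.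
have [d /= d0 hd] : exists2 d : R, 0 < d & forall u, 0 < u -> u < d -> `|f u - L| <= e / 2.
  have /cvgrPdist_le/(_ _ e20)[d /= d0 hd] := fL.
  exists d => // u u0 ud; rewrite distrC; apply: hd => //=.
  by rewrite sub0r normrN gtr0_norm.
pose B' := `|B| + `|L|.
have B'0 : 0 <= B' by rewrite addr_ge0.
have fB' u : 0 < u -> `|f u - L| <= B'.
  move=> u0; rewrite (le_trans (ler_normB _ _))// lerD// (le_trans (fB _ u0))// ler_norm//.
have i1 := integrable_spectral_weight (ltr01 : 0 < 1 :> R).
pose m0 := \int[mu]_(u in `]0, (d / 2)[) spectral_weight 1 u.
pose m1 := \int[mu]_(u in `]0, +oo[) spectral_weight 1 u.
have sub0 : `]0, (d / 2)[ `<=` `]0, +oo[%classic.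
  by move=> u; rewrite /= !in_itv/= andbT => /andP[].
have i10 : mu.-integrable `]0, (d / 2)[ (EFin \o spectral_weight 1).
  exact: integrableS i1.
have m00 : 0 < m0.
  apply: Rintegral_gt0 => //.
  - by move=> u; rewrite /= in_itv/= => /andP[u0 _]; exact: spectral_weight_gt0.
  - by apply: lebesgue_measure_itvoo_gt0; rewrite divr_gt0.
have m10 : 0 <= m1 by apply: Rintegral_ge0 => u _; exact: spectral_weight_ge0.
have wt t u : spectral_weight t u = expR (- ((t - 1) * u ^+ 2 / 4)) * spectral_weight 1 u.
  rewrite /spectral_weight [RHS]mulrA -expRD; congr (expR _ * _).
  by field.
(* The gap between the exponential rates at [u = d] and at [u = d / 2]. *)
pose k := (d ^+ 2 / 4) - (d / 2) ^+ 2 / 4.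
have k0 : 0 < k.
  by rewrite /k (_ : _ - _ = 3 / 16 * d ^+ 2) ?mulr_gt0 ?exprn_gt0//; field.
near=> t.
have t1 : 1 < t by near: t; exact: nbhs_pinfty_gt.
have t0 : 0 < t by rewrite (lt_trans _ t1).
have it := integrable_spectral_weight t0.
pose I := \int[mu]_(u in `]0, +oo[) spectral_weight t u.
have I0 : 0 < I.
  have := kernel_mass_gt0 t0; rewrite kernel_massE pmulr_rgt0//.
have ift : mu.-integrable `]0, +oo[ (EFin \o (fun u => spectral_weight t u * f u)).
  exact: (integrable_spectral_bounded t0 mf fB).
have iftL : mu.-integrable `]0, +oo[ (EFin \o (fun u => spectral_weight t u * (f u - L))).
  apply: (integrable_spectral_bounded t0 _ fB'); exact: measurable_funB.
have Ige : expR (- ((t - 1) * ((d / 2) ^+ 2 / 4))) * m0 <= I.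
  rewrite -RintegralZl//.
  apply: (@le_trans _ _ (\int[mu]_(u in `]0, (d / 2)[) spectral_weight t u)).
    apply: le_Rintegral => //; first exact: integrable_EFinZl.
      exact: integrableS it.
    move=> u; rewrite /= in_itv/= => /andP[u0 ud].
    rewrite (wt t) ler_wpM2r ?spectral_weight_ge0// ler_expR lerN2 -mulrA.
    rewrite ler_wpM2l ?subr_ge0 ?(ltW t1)// ler_pM2r// ler_sqr ?nnegrE ltW//.
    by rewrite divr_gt0.
  rewrite fine_le ?integrable_fin_num//; first exact: integrableS it.
  apply: ge0_subset_integral => //; last by move=> u _; rewrite lee_fin spectral_weight_ge0.
  exact: (measurable_int mu).
have main : `|\int[mu]_(u in `]0, +oo[) (spectral_weight t u * (f u - L))| <=
    e / 2 * I + B' * expR (- ((t - 1) * (d ^+ 2 / 4))) * m1.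
  apply: le_trans (le_normr_Rintegral _ iftL) _ => //.
  rewrite -!RintegralZl// -RintegralD//; last 2 first.
    exact: (@integrable_EFinZl R _ _ mu _ _ (e / 2) _ it).
    exact: (@integrable_EFinZl R _ _ mu _ _ _ _ i1).
  apply: le_Rintegral => //.
  - exact: integrable_norm.
  - by apply: integrable_EFinD => //; apply: integrable_EFinZl.
  move=> u; rewrite /= in_itv/= andbT => u0.
  rewrite normrM (ger0_norm (spectral_weight_ge0 _ _)).
  have [ud|du] := ltP u d.
    apply: ler_wpDr; last by rewrite mulrC ler_wpM2r ?spectral_weight_ge0 ?hd.
    by rewrite mulr_ge0 ?spectral_weight_ge0// mulr_ge0 ?expR_ge0.
  apply: ler_wpDl; first by rewrite mulr_ge0 ?spectral_weight_ge0 ?ltW.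
  rewrite mulrC -mulrA; apply: ler_pM => //; rewrite ?spectral_weight_ge0 ?fB'//.
  rewrite (wt t) ler_wpM2r ?spectral_weight_ge0// ler_expR lerN2 -mulrA.
  by rewrite ler_wpM2l ?subr_ge0 ?(ltW t1)// ler_pM2r// ler_sqr ?nnegrE ?(ltW d0) ?(ltW u0).
have -> : L - 2 / pi * (\int[mu]_(u in `]0, +oo[) (spectral_weight t u * f u)) / kernel_mass t =
    - (\int[mu]_(u in `]0, +oo[) (spectral_weight t u * (f u - L))) / I.
  under [in RHS]eq_Rintegral do rewrite mulrBr.
  rewrite RintegralB//; last first.
    apply: eq_integrable (@integrable_EFinZl R _ _ mu _ _ L _ it) => // u _.
    by rewrite /= mulrC.
  rewrite RintegralZr// kernel_massE -/I.
  move: (2 / pi) c0 => c c0; field.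
  by rewrite !gt_eqF.
rewrite normrM normrN normfV (gtr0_norm I0) ler_pdivrMr//.
apply: le_trans main _; rewrite [in leRHS](splitr e) [leRHS]mulrDl lerD2l.
apply: (@le_trans _ _ (e / 2 * (expR (- ((t - 1) * ((d / 2) ^+ 2 / 4))) * m0))); last first.
  by rewrite ler_wpM2l// ltW.
have -> : expR (- ((t - 1) * (d ^+ 2 / 4))) =
    expR (- ((t - 1) * ((d / 2) ^+ 2 / 4))) * expR (- ((t - 1) * k)).
  by rewrite -expRD; congr expR; rewrite /k; ring.
rewrite (_ : B' * _ * m1 = expR (- ((t - 1) * ((d / 2) ^+ 2 / 4))) *
  (B' * m1 * expR (- ((t - 1) * k)))); last by ring.
rewrite [leRHS]mulrCA ler_pM2l ?expR_gt0//.
have em0 : 0 < e / 2 * m0 by rewrite mulr_gt0.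
(* It remains that [expR ((t - 1) * k)] exceeds a constant; the tangent bound makes this a linear
   condition on [t]. *)
rewrite expRN ler_pdivrMr ?expR_gt0// [leRHS]mulrC -ler_pdivrMr//.
apply: le_trans (expR_ge1Dx _); rewrite ler_wpDl//.
rewrite -ler_pdivrMr// lerBrDr.
by near: t; apply: nbhs_pinfty_ge; exact: num_real.
Unshelve. all: end_near. Qed.

End Asymptotics.

(** * Exponential integrals of the heat kernel and of [K_0] *)

HB.lock Definition heat_laplace {R : realType} (a t x : R) : R :=
  \int[lebesgue_measure]_y (expR (- (a * y)) * heat t x y).

(** This is the Mellin transform of [K_0] at [a], classically [2^(a-2) * Gamma(a/2)^2]; at [a = c]
    its value is read off from the total mass of the law of [Z_0]. *)
HB.lock Definition macdonald_laplace {R : realType} (a : R) : R :=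
  \int[lebesgue_measure]_y (expR (- (a * y)) * macdonald 0 y).

Section Laplace.
Set Implicit Arguments.
Unset Strict Implicit.
Context {R : realType}.
Implicit Types a c s t u x y : R.
Local Notation mu := (@lebesgue_measure R).
Local Notation K := macdonald.
Local Notation K0 := (macdonald 0).

Lemma heat_laplaceE a t x :
  heat_laplace a t x = \int[mu]_y (expR (- (a * y)) * heat t x y).
Proof. by rewrite heat_laplace.unlock. Qed.

Lemma macdonald_laplaceE a :
  macdonald_laplace a = \int[mu]_y (expR (- (a * y)) * K0 y).
Proof. by rewrite macdonald_laplace.unlock. Qed.

Lemma H_heat_laplace a tau t x : t < tau ->
  H a tau t x = heat_laplace a (tau - t) x.
Proof.
move=> tt; rewrite /H tt heat_laplaceE; apply: eq_Rintegral => y _.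
by rewrite heat_kernelE.
Qed.

Lemma heat_div_mass_cvg x y :
  heat t x y / kernel_mass t @[t --> +oo] --> K0 x * K0 y.
Proof.
under eq_fun do rewrite heatE.
apply: (@spectral_concentration _ (fun u => K u x * K u y) (K0 x * K0 y)).
- exact: measurable_macdonald_prod.
- by move=> u _; exact: macdonald_prod_le.
- by apply: cvgM; apply: cvg_at_right_filter; exact: continuous_macdonald.
Qed.

(** A shift of time multiplies the spectral weight by [expR (- s * u ^ 2 / 4)], whose value at
    [u = 0] is [1]. *)
Lemma kernel_mass_shift_cvg s : 0 <= s ->
  kernel_mass (t + s) / kernel_mass t @[t --> +oo] --> (1 : R).
Proof.
move=> s0; under eq_fun do rewrite kernel_massE.
pose f u := expR (- (s * u ^+ 2 / 4)).
have mf : measurable_fun setT f.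
  apply: measurableT_comp => //; apply: measurableT_comp => //.
  by apply: measurable_funM => //; apply: measurable_funM => //; exact: measurable_funX.
have fw t u : spectral_weight (t + s) u = spectral_weight t u * f u.
  rewrite /spectral_weight /f [RHS]mulrAC -expRD; congr (expR _ * _).
  by field.
have E t : \int[mu]_(u in `]0, +oo[) spectral_weight (t + s) u =
    \int[mu]_(u in `]0, +oo[) (spectral_weight t u * f u).
  by apply: eq_Rintegral => u _.
under eq_fun do rewrite E.
apply: (@spectral_concentration _ f 1) => //.
- move=> u u0; rewrite ger0_norm ?expR_ge0// /f expR_le1 oppr_le0.
  by rewrite divr_ge0// mulr_ge0 ?sqr_ge0.
- rewrite (_ : 1 = f 0); last by rewrite /f expr0n mulr0 mul0r oppr0 expR0.
  apply: cvg_at_right_filter.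
  apply: (@continuous_comp _ _ _ (fun u : R => - (s * u ^+ 2 / 4)) expR).
    by apply: cvgN; apply: cvgMr_tmp; apply: cvgMl_tmp; exact: exprn_continuous.
  exact: continuous_expR.
Qed.

(** Dominated convergence is applied along sequences, and its bounds must hold for every index.
    Replacing [v n] by [Num.max (b + 1) (v n)] changes finitely many terms only. *)
Lemma cvg_pinfty_gt_seq (b : R) (f : R -> R) (l : R) :
  (forall v : nat -> R, (forall n, b < v n) -> v n @[n --> \oo] --> +oo ->
     f (v n) @[n --> \oo] --> l) -> f t @[t --> +oo] --> l.
Proof.
move=> h; apply/cvg_pinftyP => v voo; pose w n := Num.max (b + 1) (v n).
have wv : \forall n \near \oo, w n = v n.
  have /cvgryPge/(_ (b + 1)) := voo; apply: filterS => n vn; exact/max_idPr.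
have : f (w n) @[n --> \oo] --> l.
  apply: h => [n|]; first by rewrite lt_max ltrDl ltr01.
  apply: cvg_trans voo; apply: near_eq_cvg.
  by apply: filterS wv => n ->.
apply: cvg_trans; apply: near_eq_cvg.
by apply: filterS wv => n ->.
Qed.

Lemma measurable_expRN_mul a : measurable_fun setT (fun y => expR (- (a * y))).
Proof.
by apply: measurableT_comp => //; apply: measurableT_comp.
Qed.

Lemma integrable_macdonald_laplace a : 0 < a ->
  mu.-integrable setT (EFin \o (fun y => expR (- (a * y)) * K0 y)).
Proof.
(* The bound on [K0] is taken with exponent [a / 2] on the right half-line and [2 * a] on the left
   one, so that the product decays at both ends. *)
move=> a0; have a20 : 0 < a / 2 by rewrite divr_gt0.
have a22 : 0 < 2 * a by rewrite mulr_gt0.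
have [A A0 hA] := macdonald0_le_expR a20; have [B B0 hB] := macdonald0_le_expR a22.
apply: (@le_integrable_EFin R _ _ mu _ _
  (fun y => (A + B) * expR (- (a / 2 * `|y|)))) => //.
- apply: measurable_funM; first exact: measurable_expRN_mul.
  exact: (measurableT_comp (@measurable_macdonald R) (pair1_measurable (0 : R))).
- move=> y _; rewrite ger0_norm ?mulr_ge0 ?expR_ge0 ?macdonald0_ge0//.
  have [y0|y0] := leP 0 y.
    apply: (le_trans (ler_wpM2l (expR_ge0 _) (hA y))).
    rewrite ger0_norm// mulrCA -expRD (_ : _ + _ = - (a / 2 * y)); last by field.
    by rewrite ler_wpM2r ?expR_ge0// lerDl ltW.
  apply: (le_trans (ler_wpM2l (expR_ge0 _) (hB y))).
  rewrite ltr0_norm// mulrCA -expRD.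
  apply: ler_pM => //; rewrite ?expR_ge0 ?lerDr ?(ltW A0) ?(ltW B0)//.
  rewrite ler_expR -subr_ge0 (_ : _ - _ = a / 2 * (- y)); last by field.
  by rewrite mulr_ge0 ?ltW// oppr_gt0.
- by apply: integrable_EFinZl => //; exact: integrable_expRN_norm.
Qed.

Lemma macdonald_laplace_gt0 a : 0 < a -> 0 < macdonald_laplace a.
Proof.
move=> a0; rewrite macdonald_laplaceE; apply: Rintegral_gt0 => //.
- exact: integrable_macdonald_laplace.
- by move=> y _; rewrite mulr_gt0 ?expR_gt0 ?macdonald0_gt0.
- apply: (lt_le_trans (lebesgue_measure_itvoy_gt0 (0 : R))).
  by apply: le_measure; rewrite ?inE.
Qed.

Lemma measurable_heat1 t x : measurable_fun setT (heat t x).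
Proof. exact: (measurableT_comp (@measurable_heat R t) (pair1_measurable x)). Qed.

Lemma laplace_heat_le a t x y : 0 < t ->
  `|expR (- (a * y)) * heat t x y| <=
  kernel_mass t * K0 x * (expR (- (a * y)) * K0 y).
Proof.
move=> t0; rewrite normrM (ger0_norm (expR_ge0 _)).
apply: (le_trans (ler_wpM2l (expR_ge0 _) (heat_le x y t0))).
by rewrite le_eqVlt; apply/orP; left; apply/eqP; ring.
Qed.

Lemma integrable_laplace_heat a t x : 0 < a -> 0 < t ->
  mu.-integrable setT (EFin \o (fun y => expR (- (a * y)) * heat t x y)).
Proof.
move=> a0 t0; apply: (@le_integrable_EFin R _ _ mu _ _
  (fun y => kernel_mass t * K0 x * (expR (- (a * y)) * K0 y))) => //.
- apply: measurable_funM; first exact: measurable_expRN_mul.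
  exact: measurable_heat1.
- by move=> y _; exact: laplace_heat_le.
- by apply: integrable_EFinZl => //; exact: integrable_macdonald_laplace.
Qed.

Lemma heat_laplace_le a t x : 0 < a -> 0 < t ->
  `|heat_laplace a t x| <= kernel_mass t * macdonald_laplace a * K0 x.
Proof.
move=> a0 t0; have i1 := integrable_laplace_heat x a0 t0.
have i2 := integrable_macdonald_laplace a0.
rewrite heat_laplaceE macdonald_laplaceE mulrAC.
apply: le_trans (le_normr_Rintegral _ i1) _ => //.
rewrite -RintegralZl//; apply: le_Rintegral => //.
- exact: integrable_norm.
- exact: integrable_EFinZl.
- by move=> y _; exact: laplace_heat_le.
Qed.

Lemma measurable_heat_laplace a t : measurable_fun setT (heat_laplace a t).
Proof.
rewrite (_ : heat_laplace a t = fun x => \int[mu]_y (expR (- (a * y)) * heat t x y)).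
  apply: (@measurable_Rintegral R _ _ _ _ mu _
    (fun x y => expR (- (a * y)) * heat t x y)) => //.
  apply: measurable_funM; last exact: measurable_heat.
  exact: (measurableT_comp (measurable_expRN_mul a) measurable_snd).
by apply/funext => x; rewrite heat_laplaceE.
Qed.

Lemma heat_laplace_div_mass_cvg a x : 0 < a ->
  heat_laplace a t x / kernel_mass t @[t --> +oo] --> macdonald_laplace a * K0 x.
Proof.
move=> a0; apply: (cvg_pinfty_gt_seq (b := 0)) => v v0 voo.
have i2 := integrable_macdonald_laplace a0.
have E n : heat_laplace a (v n) x / kernel_mass (v n) =
    \int[mu]_y (expR (- (a * y)) * heat (v n) x y / kernel_mass (v n)).
  by rewrite heat_laplaceE -RintegralZr//; exact: integrable_laplace_heat.
under eq_fun do rewrite E.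
have -> : macdonald_laplace a * K0 x =
    \int[mu]_y (K0 x * (expR (- (a * y)) * K0 y)).
  by rewrite macdonald_laplaceE RintegralZl// mulrC.
apply: (@dominated_cvg_Rintegral R _ _ mu _ _ _
  (fun y => K0 x * (expR (- (a * y)) * K0 y))) => //.
- move=> n; apply: measurable_funM => //; apply: measurable_funM.
    exact: measurable_expRN_mul.
  exact: measurable_heat1.
- move=> y _; rewrite mulrCA; under eq_fun do rewrite -mulrA.
  apply: cvgMl_tmp.
  by have /cvg_pinftyP := @heat_div_mass_cvg x y; exact.
- exact: integrable_EFinZl.
- move=> n y _; rewrite normrM normfV (gtr0_norm (kernel_mass_gt0 (v0 n))).
  rewrite ler_pdivrMr ?kernel_mass_gt0//.
  apply: le_trans (laplace_heat_le a x y (v0 n)) _.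
  by rewrite le_eqVlt; apply/orP; left; apply/eqP; ring.
Qed.

Lemma integrable_laplace2 a c t : 0 < a -> 0 < c -> 0 < t ->
  mu.-integrable setT (EFin \o (fun x => expR (- (c * x)) * heat_laplace a t x)).
Proof.
move=> a0 c0 t0; apply: (@le_integrable_EFin R _ _ mu _ _
  (fun x => kernel_mass t * macdonald_laplace a * (expR (- (c * x)) * K0 x))) => //.
- apply: measurable_funM; first exact: measurable_expRN_mul.
  exact: measurable_heat_laplace.
- move=> x _; rewrite normrM (ger0_norm (expR_ge0 _)).
  apply: (le_trans (ler_wpM2l (expR_ge0 _) (heat_laplace_le x a0 t0))).
  by rewrite le_eqVlt; apply/orP; left; apply/eqP; ring.
- by apply: integrable_EFinZl => //; exact: integrable_macdonald_laplace.
Qed.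

Lemma laplace2_div_mass_cvg a c : 0 < a -> 0 < c ->
  (\int[mu]_x (expR (- (c * x)) * heat_laplace a t x)) / kernel_mass t
    @[t --> +oo] --> macdonald_laplace a * macdonald_laplace c.
Proof.
move=> a0 c0; apply: (cvg_pinfty_gt_seq (b := 0)) => v v0 voo.
have i2 := integrable_macdonald_laplace c0.
have E n : \int[mu]_x (expR (- (c * x)) * heat_laplace a (v n) x) / kernel_mass (v n) =
    \int[mu]_x (expR (- (c * x)) * heat_laplace a (v n) x / kernel_mass (v n)).
  by rewrite -RintegralZr//; exact: integrable_laplace2.
under eq_fun do rewrite E.
have -> : macdonald_laplace a * macdonald_laplace c =
    \int[mu]_x (macdonald_laplace a * (expR (- (c * x)) * K0 x)).
  by rewrite RintegralZl// -macdonald_laplaceE.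
apply: (@dominated_cvg_Rintegral R _ _ mu _ _ _
  (fun x => macdonald_laplace a * (expR (- (c * x)) * K0 x))) => //.
- move=> n; apply: measurable_funM => //; apply: measurable_funM.
    exact: measurable_expRN_mul.
  exact: measurable_heat_laplace.
- move=> x _; rewrite mulrCA; under eq_fun do rewrite -mulrA.
  apply: cvgMl_tmp.
  by have /cvg_pinftyP := @heat_laplace_div_mass_cvg a x a0; exact.
- exact: integrable_EFinZl.
- move=> n x _; rewrite normrM normfV (gtr0_norm (kernel_mass_gt0 (v0 n))).
  rewrite ler_pdivrMr ?kernel_mass_gt0// normrM (ger0_norm (expR_ge0 _)).
  apply: (le_trans (ler_wpM2l (expR_ge0 _) (heat_laplace_le x a0 (v0 n)))).
  by rewrite le_eqVlt; apply/orP; left; apply/eqP; ring.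
Qed.

End Laplace.

(** * Laws of random tuples *)

Section MeasureTools.
Set Implicit Arguments.
Unset Strict Implicit.
Context {R : realType}.

Lemma tonelli_in d1 d2 (T1 : measurableType d1) (T2 : measurableType d2)
    (m1 : {sigma_finite_measure set T1 -> \bar R})
    (m2 : {sigma_finite_measure set T2 -> \bar R}) (A : set T1) (B : set T2)
    (F : T1 -> T2 -> \bar R) :
  measurable A -> measurable B ->
  measurable_fun setT (fun z : T1 * T2 => F z.1 z.2) ->
  (forall x y, 0 <= F x y)%E ->
  (\int[m1]_(x in A) \int[m2]_(y in B) F x y =
   \int[m2]_(y in B) \int[m1]_(x in A) F x y)%E.
Proof.
move=> mA mB mF F0.
pose f (z : T1 * T2) : \bar R := (F z.1 z.2 * (\1_A z.1 * \1_B z.2)%:E)%E.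
have mf : measurable_fun setT f.
  apply: emeasurable_funM => //; apply/measurable_EFinP; apply: measurable_funM.
    exact: (measurableT_comp (measurable_indic mA) measurable_fst).
  exact: (measurableT_comp (measurable_indic mB) measurable_snd).
have f0 z : (0 <= f z)%E by rewrite mule_ge0// lee_fin mulr_ge0.
transitivity (\int[m1]_x \int[m2]_y f (x, y))%E.
  rewrite integral_mkcond; apply: eq_integral => x _; rewrite patchE.
  case: ifPn => xA.
    rewrite integral_mkcond; apply: eq_integral => y _; rewrite patchE /f /= !indicE xA.
    by case: ifP => _; rewrite ?mul1r ?mule1 ?mul0r ?mule0.
  rewrite integral0_eq// => y _; rewrite /f /= !indicE (negbTE xA) mul0r mule0//.
rewrite (fubini_tonelli f mf f0).
rewrite [RHS]integral_mkcond; apply: eq_integral => y _; rewrite patchE.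
case: ifPn => yB.
  rewrite [RHS]integral_mkcond; apply: eq_integral => x _; rewrite patchE /f /= !indicE yB.
  by case: ifP => _; rewrite ?mul1r ?mule1 ?mul0r ?mule0.
rewrite integral0_eq// => x _; rewrite /f /= !indicE (negbTE yB) mulr0 mule0//.
Qed.

(** This links the topology of row vectors to the product sigma-algebra of tuples. Rounding each
    coordinate down to a multiple of [1 / (k + 1)] gives a map with countably many values and box
    fibres, and [g] of the rounded point converges to [g]. *)
Lemma measurable_tuple_cvg n (g : 'rV[R]_n -> R) : continuous g ->
  measurable_fun [set: n.-tuple R] (fun v => g (\row_i tnth v i)).
Proof.
move=> cg.
pose F (k : nat) (v : n.-tuple R) : n.-tuple int :=
  [tuple Num.floor (k.+1%:R * tnth v i) | i < n].
pose G (k : nat) (z : n.-tuple int) : R := g (\row_i ((tnth z i)%:~R / k.+1%:R)).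
apply: (@measurable_fun_cvg _ _ _ _ (fun k v => G k (F k v))).
- move=> k _ Y mY; rewrite setTI.
  have -> : (fun v => G k (F k v)) @^-1` Y =
      \bigcup_(z : n.-tuple int)
        (if `[< Y (G k z) >] then F k @^-1` [set z] else set0).
    apply/seteqP; split => [v /= Yv|v [z _]].
      by exists (F k v) => //; rewrite ifT//; apply/asboolP.
    by case: ifPn => // /asboolP YG /= ->.
  apply: countable_bigcupT_measurable; first exact: countableP.
  move=> z; case: ifP => // _.
  have -> : F k @^-1` [set z] = \bigcap_(i in [set: 'I_n])
      ((fun v : n.-tuple R => tnth v i) @^-1`
        `[(tnth z i)%:~R / k.+1%:R, (tnth z i + 1)%:~R / k.+1%:R[).
    apply/seteqP; split => v /=.
      move=> Fz i _ /=; have /andP[h1 h2] := real_floor_itv (num_real (k.+1%:R * tnth v i)).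
      rewrite in_itv/= -Fz tnth_mktuple ler_pdivrMr// ltr_pdivlMr//.
      by rewrite (mulrC (tnth v i)) h1.
    move=> h; apply: eq_from_tnth => i.
    rewrite tnth_mktuple; have := h i Logic.I; rewrite /= in_itv/=.
    by rewrite ler_pdivrMr// ltr_pdivlMr// (mulrC (tnth v _)) => /floor_def.
  apply: fin_bigcap_measurable => [|i _]; first exact: finite_finset.
  rewrite -[X in measurable X]setTI; exact: measurable_tnth.
- move=> v _.
  suff : (\row_i ((tnth (F k v) i)%:~R / k.+1%:R) : 'rV[R]_n) @[k --> \oo] -->
      (\row_i tnth v i : 'rV[R]_n) by move=> h; exact: (cvg_comp _ _ h (cg _)).
  apply/cvg_ballP => e e0.
  have [N _ hN] := @cvgr0_norm_lt R R^o _ _ _ _ (@cvg_harmonic R) e e0.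
  exists N => // k Nk; split => // i j; rewrite !mxE tnth_mktuple /ball/=.
  have /andP[h1 h2] := real_floor_itv (num_real (k.+1%:R * tnth v j)).
  have k0 : 0 < k.+1%:R :> R by [].
  apply: le_lt_trans (hN k Nk) => /=; rewrite [leRHS]ger0_norm ?invr_ge0//.
  rewrite ger0_norm.
    rewrite lerBlDr -[X in _ <= X + _]mul1r -mulrDl ler_pdivlMr// mulrC ltW//.
    by move: h2; rewrite intrD addrC.
  by rewrite subr_ge0 ler_pdivrMr// [leRHS]mulrC.
Qed.

Definition tuple_box n (B : 'I_n -> set R) : set (n.-tuple R) :=
  [set v | forall i, B i (tnth v i)].

Lemma measurable_tuple_box n (B : 'I_n -> set R) :
  (forall i, measurable (B i)) -> measurable (tuple_box B).
Proof.
move=> mB; rewrite (_ : tuple_box B = \bigcap_(i in [set: 'I_n])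
    ((fun v : n.-tuple R => tnth v i) @^-1` B i)); last first.
  by apply/seteqP; split => v h i; [move=> _; exact: h|exact: h].
apply: fin_bigcap_measurable => [|i _]; first exact: finite_finset.
by rewrite -[X in measurable X]setTI; exact: measurable_tnth.
Qed.

(** A generator, which constrains one coordinate, is a box whose other sides are the whole line. *)
Lemma measurable_tuple_boxE n : @measurable _ (n.-tuple R) =
  <<s [set tuple_box B | B in [set B : 'I_n -> set R | forall i, measurable (B i)]] >>.
Proof.
apply/seteqP; split; last first.
  apply: smallest_sub; first exact: sigma_algebra_measurable.
  by move=> _ [B mB <-]; exact: measurable_tuple_box.
apply: smallest_sub; first exact: smallest_sigma_algebra.
move=> A; rewrite -bigcup_seq => -[i _ [Y mY <-]]; rewrite setTI.
apply: sub_sigma_algebra; exists (fun j => if j == i then Y else setT).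
  by move=> j; case: ifP.
apply/seteqP; split => v /= h; first by have := h i; rewrite eqxx.
by move=> j; case: eqP => // ->.
Qed.

(** The right-hand side is a measure in [E], and boxes form a generating class stable under
    intersection, so agreement on boxes suffices. *)
Lemma tuple_law_eq n d1 d2 (T1 : measurableType d1) (T2 : measurableType d2)
    (P1 : probability T1 R) (m2 : {measure set T2 -> \bar R})
    (X1 : {RV P1 >-> n.-tuple R}) (X2 : T2 -> n.-tuple R) (k : T2 -> \bar R) :
  measurable_fun setT X2 -> measurable_fun setT k -> (forall w, 0 <= k w)%E ->
  (forall B : 'I_n -> set R, (forall i, measurable (B i)) ->
    P1 (X1 @^-1` tuple_box B) = \int[m2]_(w in X2 @^-1` tuple_box B) k w)%E ->
  forall E, measurable E ->
    (P1 (X1 @^-1` E) = \int[m2]_(w in X2 @^-1` E) k w)%E.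
Proof.
move=> mX2 mk k0 H E mE.
pose nu (E : set (n.-tuple R)) : \bar R := (\int[m2]_(w in X2 @^-1` E) k w)%E.
have mX2E (A : set (n.-tuple R)) : measurable A -> measurable (X2 @^-1` A).
  by move=> mA; rewrite -[X in measurable X]setTI; exact: mX2.
have nu0 : nu set0 = 0%E by rewrite /nu preimage_set0 integral_set0.
have nu_ge0 A : (0 <= nu A)%E by exact: integral_ge0.
have nu_sigma : semi_sigma_additive nu.
  move=> A mA tA mUA; rewrite /nu preimage_bigcup ge0_integral_bigcup//.
  - apply: is_cvg_ereal_nneg_natsum_cond => i _ _; exact: nu_ge0.
  - by move=> i; exact: mX2E.
  - exact: measurable_funTS.
  - apply/trivIsetP => i j _ _ ij; rewrite -preimage_setI.
    by move/trivIsetP : tA => /(_ i j Logic.I Logic.I ij) ->; rewrite preimage_set0.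
pose nuM : {measure set (n.-tuple R) -> \bar R} :=
  HB.pack nu (isMeasure.Build _ _ _ nu nu0 nu_ge0 nu_sigma).
apply: (measure_unique _ (fun=> setT) (measurable_tuple_boxE n) _ _ _
  (distribution P1 X1) nuM) => //.
- move=> _ _ [B mB <-] [B' mB' <-]; exists (fun i => B i `&` B' i).
    by move=> i; exact: measurableI.
  apply/seteqP; split => v /=.
    by move=> h; split => i; have [] := h i.
  by move=> [h h'] i; split; [exact: h|exact: h'].
- by move=> _; exists (fun=> setT) => //; apply/seteqP; split.
- by rewrite bigcup_const.
- by move=> _ [B mB <-]; exact: H.
- by move=> _; rewrite ltey_eq fin_num_measure.
Qed.

End MeasureTools.

(** * The limit process *)

Section NaturalFiltration.
Set Implicit Arguments.
Unset Strict Implicit.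
Context {R : realType} {d : measure_display} {T : measurableType d}.
Context (P : probability T R) (I : set R) (X : R -> {RV P >-> R}).

Lemma measurable_preimage_RV t (B : set R) : measurable B -> measurable (X t @^-1` B).
Proof. by move=> mB; rewrite -[X in measurable X]setTI; exact: measurable_funPT. Qed.

Lemma natural_filtration_measurable s A : natural_filtration I X s A -> measurable A.
Proof.
apply: smallest_sub; first exact: sigma_algebra_measurable.
by move=> _ [r [B [_ _ mB ->]]]; exact: measurable_preimage_RV.
Qed.

Lemma natural_filtration_preimage s r (B : set R) : I r -> r <= s -> measurable B ->
  natural_filtration I X s (X r @^-1` B).
Proof. by move=> Ir rs mB; apply: sub_sigma_algebra; exists r, B. Qed.

Lemma natural_filtrationT s : natural_filtration I X s setT.
Proof.
rewrite /natural_filtration; set G := [set A | _]; exact: (@measurableT _ (g_sigma_algebraType G)).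
Qed.

Lemma natural_filtrationI s A B : natural_filtration I X s A ->
  natural_filtration I X s B -> natural_filtration I X s (A `&` B).
Proof.
rewrite /natural_filtration; set G := [set A | _]; exact: (@measurableI _ (g_sigma_algebraType G)).
Qed.

Lemma natural_filtration_le s t A : s <= t -> natural_filtration I X s A ->
  natural_filtration I X t A.
Proof.
move=> st; apply: smallest_sub; first exact: smallest_sigma_algebra.
move=> _ [r [B [Ir rs mB ->]]]; apply: sub_sigma_algebra; exists r, B.
by split => //; exact: le_trans st.
Qed.

End NaturalFiltration.

Definition Z_kernel {R : realType} (t x y : R) : R :=
  macdonald 0 y / macdonald 0 x * heat t x y.

HB.lock Definition Z_norm {R : realType} (c : R) : R :=
  4 / (2 `^ c * complex.Re (Gamma (c / 2)%:C%C) ^+ 2).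

Section LimitProcess.
Set Implicit Arguments.
Unset Strict Implicit.
Context {R : realType} (c : R) (c0 : 0 < c).
Context {d : measure_display} {T : measurableType d} (P : probability T R).
Context (Z : R -> {RV P >-> R}).
Context (hZ : markov_process `[0, +oo[ Z (Z_initial_density c) Z_transition_density).
Implicit Types s t x y : R.
Local Notation mu := (@lebesgue_measure R).
Local Notation K0 := (macdonald 0).

Lemma Z_initial_densityE (x : R) :
  Z_initial_density c x = Z_norm c * (expR (- (c * x)) * K0 x).
Proof. by rewrite /Z_initial_density Z_norm.unlock besselK0_macdonald; ring. Qed.

Lemma Z_transition_densityE (s t x y : R) :
  Z_transition_density s t x y = Z_kernel (t - s) x y.
Proof. by rewrite /Z_transition_density !besselK0_macdonald heat_kernelE. Qed.

Lemma Z0_law B : measurable B ->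
  (P (Z 0 @^-1` B) = \int[mu]_(x in B) (Z_norm c * (expR (- (c * x)) * K0 x))%:E)%E.
Proof.
case: hZ => h _ _ mB; rewrite h//.
by apply: eq_integral => x _; rewrite Z_initial_densityE.
Qed.

Lemma integrable_Z0 : mu.-integrable setT
  (EFin \o (fun x => Z_norm c * (expR (- (c * x)) * K0 x))).
Proof. by apply: integrable_EFinZl => //; exact: integrable_macdonald_laplace. Qed.

Lemma Z_norm_laplace : Z_norm c * macdonald_laplace c = 1.
Proof.
have := Z0_law measurableT; rewrite preimage_setT probability_setT.
move=> /(congr1 fine) /=; rewrite macdonald_laplaceE -RintegralZl//.
exact: integrable_macdonald_laplace.
Qed.

Lemma Z_norm_gt0 : 0 < Z_norm c.
Proof.
by rewrite -(pmulr_lgt0 _ (macdonald_laplace_gt0 c0)) Z_norm_laplace.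
Qed.

Lemma Z_markov s t (B : set R) (A : set T) : 0 <= s -> s < t -> measurable B ->
  natural_filtration `[0, +oo[ Z s A ->
  (P (A `&` Z t @^-1` B) =
   \int[P]_(w in A) \int[mu]_(y in B) (Z_kernel (t - s) (Z s w) y)%:E)%E.
Proof.
move=> s0 st mB hA; case: hZ => _ _ h.
rewrite (h s t B A)//=; rewrite ?in_itv/= ?s0 ?(ltW (le_lt_trans s0 st))//.
apply: eq_integral => w _; apply: eq_integral => y _.
by rewrite Z_transition_densityE.
Qed.

Lemma measurable_Z_transition t (B : set R) : 0 < t -> measurable B ->
  measurable_fun setT (fun x => \int[mu]_(y in B) (Z_kernel t x y)%:E)%E.
Proof.
move=> t0 mB; case: hZ => _ h _.
have := h 0 t B; rewrite /= !in_itv/= lexx (ltW t0) => /(_ isT isT t0 mB).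
apply: eq_measurable_fun => x _; rewrite /transition_probability.
by apply: eq_integral => y _; rewrite Z_transition_densityE subr0.
Qed.

Lemma Z0_interval_gt0 (a b : R) : a < b -> (0 < P (Z 0 @^-1` `]a, b[))%E.
Proof.
move=> ab; rewrite Z0_law//.
have i : mu.-integrable `]a, b[ (EFin \o (fun x => Z_norm c * (expR (- (c * x)) * K0 x))).
  by apply: integrableS integrable_Z0.
rewrite -[ltRHS]fineK ?integrable_fin_num// lte_fin; apply: Rintegral_gt0 => //.
- by move=> x _; rewrite mulr_gt0 ?Z_norm_gt0// mulr_gt0 ?expR_gt0 ?macdonald0_gt0.
- exact: lebesgue_measure_itvoo_gt0.
Qed.

(* A negative value of the kernel would persist on a box [U x V], and then
   [P (Z_0 in U, Z_t in V)] would be negative. *)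
Lemma heat_ge0 t x y : 0 < t -> 0 <= heat t x y.
Proof.
move=> t0; rewrite leNgt; apply/negP => p0.
have [e e0 [d0 d00 hneg]] := heat_lt0_near t0 p0.
pose U := `](x - d0), (x + d0)[%classic : set R.
pose V := `](y - d0), (y + d0)[%classic : set R.
have mU : measurable U by exact: measurable_itv.
have mV : measurable V by exact: measurable_itv.
have inb (z z0 : R) : `](z0 - d0), (z0 + d0)[%classic z -> `|z - z0| < d0.
  by rewrite /= in_itv/= ltr_distl.
(* As [K0] is nondecreasing, [K0 y' / K0 x'] is bounded below on the box by this corner value. *)
pose e1 := K0 (y - d0) / K0 (x + d0) * e.
have e10 : 0 < e1 by rewrite mulr_gt0// divr_gt0 ?macdonald0_gt0.
have neg x' y' : U x' -> V y' -> e1 <= - Z_kernel t x' y'.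
  move=> Ux Vy; rewrite /(Z_kernel t x' y') -mulrN /e1.
  have h := hneg _ _ (inb _ _ Ux) (inb _ _ Vy).
  apply: ler_pM; rewrite ?(ltW e0)//; last by rewrite lerNr.
    by rewrite ltW// divr_gt0 ?macdonald0_gt0.
  move: Ux Vy; rewrite /U /V /= !in_itv/= => /andP[_ Ux] /andP[Vy _].
  apply: ler_pM; rewrite ?invr_ge0 ?macdonald0_ge0//.
    exact/macdonald0_nondecreasing/ltW.
  rewrite lef_pV2 ?posrE ?macdonald0_gt0//.
  exact/macdonald0_nondecreasing/ltW.
have mk x' : measurable_fun setT (fun y' => Z_kernel t x' y').
  apply: measurable_funM; last exact: measurable_heat1.
  apply: measurable_funM => //.
  exact: (measurableT_comp (@measurable_macdonald R) (pair1_measurable (0 : R))).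
pose e2 := e1 * fine (mu V).
have muV : (mu V < +oo)%E.
  by rewrite lebesgue_measure_itv/=; case: ifP => _; rewrite ?ltry// -EFinB ltry.
have muV0 : (0 < mu V)%E.
  by apply: lebesgue_measure_itvoo_gt0; rewrite ltrD2l gt0_cp.
have e20 : 0 < e2 by rewrite mulr_gt0// fine_gt0// muV0.
have negV x' : U x' -> (\int[mu]_(y' in V) (Z_kernel t x' y')%:E <= (- e2)%:E)%E.
  move=> Ux.
  have -> : (\int[mu]_(y' in V) (Z_kernel t x' y')%:E =
      - \int[mu]_(y' in V) (- Z_kernel t x' y')%:E)%E.
    rewrite -integral_ge0N; last first.
      by move=> y' Vy; rewrite lee_fin (le_trans (ltW e10))// neg.
    by apply: eq_integral => y' _; rewrite EFinN oppeK.
  rewrite EFinN leeN2 /e2 EFinM fineK ?ge0_fin_numE// -integral_cst//.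
  apply: ge0_le_integral => //.
  - by move=> y' _; rewrite lee_fin ltW.
  - by apply/measurable_EFinP/measurable_funTS; apply: measurableT_comp => //; exact: mk.
  - by move=> y' Vy; rewrite lee_fin neg.
have Z0U := Z0_interval_gt0 (_ : x - d0 < x + d0).
have {}Z0U : (0 < P (Z 0 @^-1` U))%E by apply: Z0U; rewrite ltrD2l gt0_cp.
have := @Z_markov 0 t V (Z 0 @^-1` U) (lexx _) t0 mV.
rewrite subr0 => /(_ _)/Wrap[].
  by apply: natural_filtration_preimage => //; rewrite /= in_itv/= lexx.
move=> hP; have : (0 <= P (Z 0 @^-1` U `&` Z t @^-1` V))%E by exact: measure_ge0.
rewrite {}hP leNgt => /negP; apply.
have mZU : measurable (Z 0 @^-1` U) by exact: measurable_preimage_RV.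
apply: (@le_lt_trans _ _ (- (e2%:E * P (Z 0 @^-1` U)))%E); last first.
  by rewrite oppe_lt0 mule_gt0// lte_fin.
pose g w := (- \int[mu]_(y' in V) (Z_kernel t (Z 0 w) y')%:E)%E.
have gE w : (Z 0 @^-1` U) w -> (e2%:E <= g w)%E.
  by move=> Uw; rewrite /g leeNr -EFinN negV.
have -> : (\int[P]_(w in Z 0 @^-1` U) \int[mu]_(y' in V) (Z_kernel t (Z 0 w) y')%:E =
    - \int[P]_(w in Z 0 @^-1` U) g w)%E.
  rewrite -integral_ge0N; last first.
    by move=> w Uw; rewrite (le_trans _ (gE _ Uw))// lee_fin ltW.
  by apply: eq_integral => w _; rewrite /g oppeK.
rewrite leeN2 -integral_cst//; apply: ge0_le_integral => //.
- by move=> w _; rewrite lee_fin ltW.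
- rewrite /g; apply: measurableT_comp => //; apply: measurable_funTS.
  exact: (measurableT_comp (measurable_Z_transition t0 mV) (measurable_funPT (Z 0))).
Qed.

End LimitProcess.

(** * Integrals against the law of the limit process *)

Section LimitProcessIntegrals.
Set Implicit Arguments.
Unset Strict Implicit.
Context {R : realType} (c : R) (c0 : 0 < c).
Context {d : measure_display} {T : measurableType d} (P : probability T R).
Context (Z : R -> {RV P >-> R}).
Context (hZ : markov_process `[0, +oo[ Z (Z_initial_density c) Z_transition_density).
Implicit Types a s t x y : R.
Local Notation mu := (@lebesgue_measure R).
Local Notation K0 := (macdonald 0).

Lemma measurable_macdonald0 : measurable_fun setT (fun y : R => K0 y).
Proof. exact: (measurableT_comp (@measurable_macdonald R) (pair1_measurable (0 : R))). Qed.

Lemma Z_kernel_ge0 t x y : 0 < t -> 0 <= Z_kernel t x y.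
Proof.
move=> t0; rewrite mulr_ge0 ?(heat_ge0 c0 hZ)// divr_ge0 ?macdonald0_ge0//.
Qed.

Lemma measurable_Z_kernel t :
  measurable_fun setT (fun z : R * R => Z_kernel t z.1 z.2).
Proof.
apply: measurable_funM; last exact: measurable_heat.
apply: measurable_funM.
  exact: (measurableT_comp measurable_macdonald0 measurable_snd).
apply: measurable_funV_gt0; first by move=> z; exact: macdonald0_gt0.
exact: (measurableT_comp measurable_macdonald0 measurable_fst).
Qed.

Lemma Z0_integral (f : R -> \bar R) : measurable_fun setT f -> (forall x, 0 <= f x)%E ->
  (\int[P]_w f (Z 0 w) =
   \int[mu]_x (f x * (Z_norm c * (expR (- (c * x)) * K0 x))%:E))%E.
Proof.
move=> mf f0.
have k0 x : (0 <= (Z_norm c * (expR (- (c * x)) * K0 x))%:E)%E.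
  by rewrite lee_fin mulr_ge0 ?(ltW (Z_norm_gt0 c0 hZ))// mulr_ge0 ?expR_ge0 ?macdonald0_ge0.
have mk : measurable_fun setT (fun x : R => (Z_norm c * (expR (- (c * x)) * K0 x))%:E).
  apply/measurable_EFinP; apply: measurable_funM => //; apply: measurable_funM.
    exact: measurable_expRN_mul.
  exact: measurable_macdonald0.
have := @eq_weighted_integral R _ _ _ _ _ _ P mu setT setT (Z 0) id (cst 1%E) _
  measurableT measurableT (measurable_funPT (Z 0)) (@measurable_id _ _ _)
  (measurable_cst _) mk (fun _ => lee01) k0 _ f mf f0.
move=> H; rewrite -H; first by apply: eq_integral => w _; rewrite /= mule1.
move=> B mB; rewrite !setTI integral_cst ?mul1e; first exact: Z0_law hZ _ mB.
exact: measurable_preimage_RV.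
Qed.

(** By Tonelli's theorem the law of [Z t] on the event [A] has the density [k], the integral of the
    kernel over [A]; sets can then be replaced by nonnegative functions. *)
Lemma Z_markov_integral s t (A : set T) (f : R -> \bar R) : 0 <= s -> s < t ->
  natural_filtration `[0, +oo[ Z s A ->
  measurable_fun setT f -> (forall x, 0 <= f x)%E ->
  (\int[P]_(w in A) f (Z t w) =
   \int[P]_(w in A) \int[mu]_y (f y * (Z_kernel (t - s) (Z s w) y)%:E))%E.
Proof.
move=> s0 st hA mf f0.
have mA := natural_filtration_measurable hA.
have q0 w y : (0 <= (Z_kernel (t - s) (Z s w) y)%:E)%E.
  by rewrite lee_fin Z_kernel_ge0// subr_gt0.
have mq : measurable_fun setT (fun z : T * R => (Z_kernel (t - s) (Z s z.1) z.2)%:E).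
  apply/measurable_EFinP; apply: (measurableT_comp (measurable_Z_kernel (t - s))
    (g := fun z : T * R => (Z s z.1, z.2))).
  apply: measurable_fun_pair => //.
  exact: (measurableT_comp (measurable_funPT (Z s)) measurable_fst).
pose k y := (\int[P]_(w in A) (Z_kernel (t - s) (Z s w) y)%:E)%E.
have k0 y : (0 <= k y)%E by exact: integral_ge0.
have mk : measurable_fun setT k.
  have m1 : measurable_fun setT
      (fun z : T * R => ((Z_kernel (t - s) (Z s z.1) z.2)%:E * (\1_A z.1)%:E)%E).
    apply: emeasurable_funM => //; apply/measurable_EFinP.
    exact: (measurableT_comp (measurable_indic mA) measurable_fst).
  have m10 z : (0 <= (Z_kernel (t - s) (Z s z.1) z.2)%:E * (\1_A z.1)%:E :> \bar R)%E.
    by rewrite mule_ge0// lee_fin.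
  have := @measurable_fun_fubini_tonelli_G _ _ _ _ R P _ m1 m10.
  apply: eq_measurable_fun => y _; rewrite /k [RHS]integral_mkcond.
  apply: eq_integral => w _; rewrite /fubini_G /= patchE indicE.
  by case: ifP => _; rewrite ?mule1 ?mule0.
rewrite (tonelli_in P mu mA measurableT
  (F := fun w y => (f y * (Z_kernel (t - s) (Z s w) y)%:E)%E)); last 2 first.
- apply: emeasurable_funM => //; exact: (measurableT_comp mf measurable_snd).
- by move=> w y; rewrite mule_ge0.
transitivity (\int[mu]_y (f y * k y))%E; last first.
  apply: eq_integral => y _; rewrite /k -ge0_integralZl//.
  apply: measurable_funTS; exact: (measurableT_comp mq (pair2_measurable y)).
have H := @eq_weighted_integral R _ _ _ _ _ _ P mu A setT (Z t) id (cst 1%E) k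
  mA measurableT (measurable_funPT (Z t)) (@measurable_id _ _ _)
  (measurable_cst _) mk (fun _ => lee01) k0 _ f mf f0.
rewrite -H; first by apply: eq_integral => w _; rewrite /= mule1.
move=> B mB; rewrite setTI integral_cst ?mul1e; last first.
  by apply: measurableI => //; exact: measurable_preimage_RV.
apply: (etrans (Z_markov hZ s0 st mB hA)).
exact: (tonelli_in P mu mA mB
  (F := fun w y => (Z_kernel (t - s) (Z s w) y)%:E)).
Qed.

Lemma heat_laplace_ge0 a t x : 0 < t -> 0 <= heat_laplace a t x.
Proof.
move=> t0; rewrite heat_laplaceE; apply: Rintegral_ge0 => y _.
by rewrite mulr_ge0 ?expR_ge0// (heat_ge0 c0 hZ).
Qed.

(* If [heat_laplace a t x = 0] then [heat t x] vanishes almost everywhere,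
   so the transition probabilities from [x] would have total mass 0. *)
Lemma heat_laplace_eq0_null a t s : 0 < a -> 0 < t -> 0 <= s ->
  P (Z s @^-1` [set x | heat_laplace a t x = 0]) = 0.
Proof.
move=> a0 t0 s0; set N := [set x | _].
have mN : measurable N.
  rewrite (_ : N = heat_laplace a t @^-1` [set 0]); last by [].
  rewrite -[X in measurable X]setTI; apply: measurable_heat_laplace => //.
have sst : s < s + t by rewrite ltrDl.
have hA : natural_filtration `[0, +oo[ Z s (Z s @^-1` N).
  by apply: natural_filtration_preimage => //; rewrite /= in_itv/= s0.
have := Z_markov hZ s0 sst measurableT hA; rewrite preimage_setT setIT => ->.
rewrite integral0_eq// => w; rewrite /N /= => Nw.
rewrite (_ : s + t - s = t); last by ring.
pose F (y : R) : R := expR (- (a * y)) * heat t (Z s w) y.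
have mI : measurable_fun setT (EFin \o F).
  apply/measurable_EFinP; apply: measurable_funM; first exact: measurable_expRN_mul.
  exact: measurable_heat1.
have iI : mu.-integrable setT (EFin \o F) := integrable_laplace_heat (Z s w) a0 t0.
have : (\int[mu]_y `|(EFin \o F) y| = 0)%E.
  transitivity (\int[mu]_y (F y)%:E)%E.
    apply: eq_integral => y _ /=.
    by rewrite ger0_norm// mulr_ge0 ?expR_ge0// (heat_ge0 c0 hZ).
  rewrite -[LHS]fineK ?integrable_fin_num//; congr EFin.
  by rewrite -[RHS]Nw heat_laplaceE.
move/(ae_eq_integral_abs mu measurableT mI) => ae0.
transitivity (\int[mu]_(y in [set: R]) cst 0%E y)%E; last by rewrite integral0.
apply: ae_eq_integral => //.
  apply/measurable_EFinP.
  exact: (measurableT_comp (measurable_Z_kernel t) (pair1_measurable (Z s w))).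
apply: filterS ae0 => y h _; have /= := h Logic.I => -[/eqP].
by rewrite mulf_eq0 gt_eqF ?expR_gt0//= => /eqP h0; rewrite /Z_kernel h0 mulr0.
Qed.

End LimitProcessIntegrals.

(** * The change of measure *)

(** The iterated form of the double integral [C_const]. *)
Definition Y_norm {R : realType} (a c tau : R) : R :=
  \int[lebesgue_measure]_x (expR (- (c * x)) * heat_laplace a tau x).

(* The density of the law of [Y] with respect to the law of [Z] on the events
   up to time [t], as a function of the position at time [t]. *)
Definition YZ_density {R : realType} (a c tau t x : R) : R :=
  heat_laplace a (tau - t) x / (Y_norm a c tau * Z_norm c * macdonald 0 x).

Section HTransform.
Set Implicit Arguments.
Unset Strict Implicit.
Context {R : realType} (a c tau : R) (a0 : 0 < a) (c0 : 0 < c) (tau0 : 0 < tau).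
Context {dY : measure_display} {TY : measurableType dY} (PY : probability TY R).
Context (Y : R -> {RV PY >-> R}).
Context (hY : markov_process `[0, tau] Y (Y_initial_density a c tau)
  (Y_transition_density a tau)).
Context {dZ : measure_display} {TZ : measurableType dZ} (PZ : probability TZ R).
Context (Z : R -> {RV PZ >-> R}).
Context (hZ : markov_process `[0, +oo[ Z (Z_initial_density c) Z_transition_density).
Implicit Types s t x y : R.
Local Notation mu := (@lebesgue_measure R).
Local Notation K0 := (macdonald 0).
Local Notation HL := (heat_laplace a).
Local Notation D := (YZ_density a c tau).

Lemma Y_initial_densityE x : Y_initial_density a c tau x =
  (C_const a c tau)^-1 * (expR (- (c * x)) * HL tau x).
Proof. by rewrite /Y_initial_density H_heat_laplace// subr0 mulrA. Qed.

Lemma Y_transition_densityE s t x y : s < t -> t < tau ->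
  Y_transition_density a tau s t x y =
  HL (tau - t) y / HL (tau - s) x * heat (t - s) x y.
Proof.
move=> st tt; rewrite /Y_transition_density !H_heat_laplace ?heat_kernelE//.
exact: lt_trans tt.
Qed.

(** The law of [Y_0] has total mass [1], and this mass is [Y_norm] divided by [C_const]. *)
Lemma C_constE : C_const a c tau = Y_norm a c tau.
Proof.
case: hY => h _ _; have := h setT measurableT; rewrite preimage_setT probability_setT.
move=> /(congr1 fine) /=.
rewrite (_ : fine _ = (C_const a c tau)^-1 * Y_norm a c tau); last first.
  rewrite /Y_norm -RintegralZl//; last exact: integrable_laplace2.
  by apply: eq_Rintegral => x _; rewrite Y_initial_densityE.
(* Since [0^-1 = 0], a vanishing constant would give total mass [0]. *)
move=> h1; have C0 : C_const a c tau != 0.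
  by apply/eqP => C0; move: h1; rewrite C0 invr0 mul0r => /eqP; rewrite oner_eq0.
by rewrite -[LHS]mulr1 h1 mulVKf.
Qed.

Lemma Y_norm_gt0 : 0 < Y_norm a c tau.
Proof.
rewrite lt_neqAle Rintegral_ge0 ?andbT; last first.
  by move=> x _; rewrite mulr_ge0 ?expR_ge0 ?(heat_laplace_ge0 c0 hZ).
apply/eqP => N0; case: hY => h _ _; have := h setT measurableT.
rewrite preimage_setT probability_setT integral0_eq => [/eqP|x _].
  by rewrite eqe oner_eq0.
by rewrite Y_initial_densityE C_constE -N0 invr0 mul0r.
Qed.

Lemma YZ_density_ge0 t x : t < tau -> 0 <= D t x.
Proof.
move=> tt; rewrite divr_ge0 ?(heat_laplace_ge0 c0 hZ) ?subr_gt0//.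
by rewrite mulr_ge0 ?macdonald0_ge0// mulr_ge0 ?ltW ?Y_norm_gt0 ?(Z_norm_gt0 c0 hZ).
Qed.

Lemma measurable_YZ_density t : measurable_fun setT (D t).
Proof.
apply: measurable_funM; first exact: measurable_heat_laplace.
apply: measurable_funV_gt0.
  by move=> x; rewrite mulr_gt0 ?macdonald0_gt0// mulr_gt0 ?Y_norm_gt0 ?(Z_norm_gt0 c0 hZ).
apply: measurable_funM => //; exact: measurable_macdonald0.
Qed.

Lemma measurable_YZ_densityZ t : measurable_fun setT (fun w => (D t (Z t w))%:E).
Proof.
apply/measurable_EFinP.
exact: (measurableT_comp (measurable_YZ_density t) (measurable_funPT (Z t))).
Qed.

(** The invariant of the induction over times: [AY] and [AZ] are corresponding events of the past at
    time [s]. Quantifying over [B] records the law of the position at [s] on these events, which the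
    Markov property needs for the next step. *)
Definition h_transform s (AY : set TY) (AZ : set TZ) : Prop :=
  [/\ natural_filtration `[0, tau] Y s AY, natural_filtration `[0, +oo[ Z s AZ &
   forall B, measurable B -> (PY (AY `&` Y s @^-1` B) =
     \int[PZ]_(w in AZ `&` Z s @^-1` B) (D s (Z s w))%:E)%E].

Lemma h_transform0 : h_transform 0 setT setT.
Proof.
split; [exact: natural_filtrationT..|move=> B mB].
rewrite !setTI; case: hY => -> // _ _.
pose f x := ((D 0 x)%:E * (\1_B x)%:E)%E.
have mf : measurable_fun setT f.
  apply: emeasurable_funM; first by apply/measurable_EFinP; exact: measurable_YZ_density.
  by apply/measurable_EFinP; exact: measurable_indic.
have f0 x : (0 <= f x)%E by rewrite mule_ge0 ?lee_fin ?YZ_density_ge0.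
transitivity (\int[PZ]_w f (Z 0 w))%E; last first.
  rewrite [RHS]integral_mkcond; apply: eq_integral => w _; rewrite patchE /f indicE.
  by rewrite (_ : (w \in Z 0 @^-1` B) = (Z 0 w \in B))//; case: ifP; rewrite ?mule1 ?mule0.
rewrite (Z0_integral c0 hZ)// integral_mkcond; apply: eq_integral => x _.
rewrite patchE /f indicE; case: ifP => _; rewrite ?mule0 ?mul0e// mule1 -EFinM; congr EFin.
rewrite Y_initial_densityE C_constE /YZ_density subr0.
have := Y_norm_gt0; have := Z_norm_gt0 c0 hZ; have := macdonald0_gt0 x.
move: (Y_norm _ _ _) (Z_norm _) (K0 x) => p q r r0 q0 p0.
by field; rewrite !gt_eqF.
Qed.

Lemma h_transformI s AY AZ B : 0 <= s -> s <= tau -> measurable B ->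
  h_transform s AY AZ -> h_transform s (AY `&` Y s @^-1` B) (AZ `&` Z s @^-1` B).
Proof.
move=> s0 st mB [hAY hAZ h]; split.
- by apply: natural_filtrationI => //; apply: natural_filtration_preimage => //; rewrite /= in_itv/= s0.
- by apply: natural_filtrationI => //; apply: natural_filtration_preimage => //; rewrite /= in_itv/= s0.
- move=> B' mB'; rewrite -(setIA AY) -(setIA AZ).
  exact: (h (B `&` B') (measurableI _ _ mB mB')).
Qed.

Lemma h_transform_integral s AY AZ (f : R -> \bar R) : s < tau ->
  h_transform s AY AZ -> measurable_fun setT f -> (forall x, 0 <= f x)%E ->
  (\int[PY]_(w in AY) f (Y s w) = \int[PZ]_(w in AZ) (f (Z s w) * (D s (Z s w))%:E))%E.
Proof.
move=> st [hAY hAZ h] mf f0.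
have mAY := natural_filtration_measurable hAY.
have mAZ := natural_filtration_measurable hAZ.
have k0 w : (0 <= (D s (Z s w))%:E)%E by rewrite lee_fin YZ_density_ge0.
have H := @eq_weighted_integral R _ _ _ _ _ _ PY PZ AY AZ (Y s) (Z s) (cst 1%E) _
  mAY mAZ (measurable_funPT (Y s)) (measurable_funPT (Z s))
  (measurable_cst _) (measurable_YZ_densityZ s) (fun _ => lee01) k0 _ f mf f0.
rewrite -H; first by apply: eq_integral => w _; rewrite /= mule1.
move=> B mB; rewrite integral_cst ?mul1e; first exact: h.
by apply: measurableI => //; exact: measurable_preimage_RV.
Qed.

(** With [q] the transition density of [Y], the quotients cancel to [q(x, y) * D s x = D t y *
    Z_kernel (t - s) x y]: the factors [HL (tau - s) x] and [K0 y] disappear. Both Markov properties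
    then turn the density at [s] into the density at [t]. *)
Lemma h_transform_lt s t AY AZ : 0 <= s -> s < t -> t < tau ->
  h_transform s AY AZ -> h_transform t AY AZ.
Proof.
move=> s0 st tt hs; have [hAY hAZ _] := hs; have stau := lt_trans st tt.
have t0 := le_lt_trans s0 st.
split; [exact: natural_filtration_le (ltW st) hAY|exact: natural_filtration_le (ltW st) hAZ|].
move=> B mB; have mAZ := natural_filtration_measurable hAZ.
have Is : `[0, tau]%classic s by rewrite /= in_itv/= s0 ltW.
have It : `[0, tau]%classic t by rewrite /= in_itv/= !ltW.
case: hY => _ hm hMarkov; rewrite (hMarkov s t B AY Is It st mB hAY).
pose q x := transition_probability (Y_transition_density a tau) s t x B.
have qE x : q x = (\int[mu]_(y in B) (HL (tau - t) y / HL (tau - s) x * heat (t - s) x y)%:E)%E.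
  by apply: eq_integral => y _; rewrite Y_transition_densityE.
have q0 x : (0 <= q x)%E.
  rewrite qE; apply: integral_ge0 => y _; rewrite lee_fin.
  by rewrite mulr_ge0 ?divr_ge0 ?(heat_laplace_ge0 c0 hZ) ?(heat_ge0 c0 hZ)// subr_gt0.
have mq : measurable_fun setT q by exact: hm.
rewrite (@h_transform_integral s AY AZ q)//.
pose f y := ((D t y)%:E * (\1_B y)%:E)%E.
have mf : measurable_fun setT f.
  apply: emeasurable_funM; first by apply/measurable_EFinP; exact: measurable_YZ_density.
  by apply/measurable_EFinP; exact: measurable_indic.
have f0 x : (0 <= f x)%E by rewrite mule_ge0 ?lee_fin ?YZ_density_ge0.
transitivity (\int[PZ]_(w in AZ) f (Z t w))%E; last first.
  rewrite [RHS]integral_mkcondr; apply: eq_integral => w _; rewrite patchE /f indicE.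
  by rewrite (_ : (w \in Z t @^-1` B) = (Z t w \in B))//; case: ifP; rewrite ?mule1 ?mule0.
rewrite (Z_markov_integral c0 hZ s0 st hAZ mf f0).
have pointwise x : HL (tau - s) x != 0 ->
    (q x * (D s x)%:E = \int[mu]_y (f y * (Z_kernel (t - s) x y)%:E))%E.
  move=> Hx; rewrite qE -ge0_integralZr//; last 3 first.
  - apply/measurable_EFinP/measurable_funTS; apply: measurable_funM; last exact: measurable_heat1.
    by apply: measurable_funM => //; exact: measurable_heat_laplace.
  - move=> y _; rewrite lee_fin.
    by rewrite mulr_ge0 ?divr_ge0 ?(heat_laplace_ge0 c0 hZ) ?(heat_ge0 c0 hZ)// subr_gt0.
  - by rewrite lee_fin YZ_density_ge0.
  rewrite integral_mkcond; apply: eq_integral => y _; rewrite patchE /f indicE.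
  case: ifP => _; rewrite ?mule1 ?mule0 ?mul0e// -!EFinM; congr EFin.
  rewrite /YZ_density /Z_kernel.
  have := Y_norm_gt0; have := Z_norm_gt0 c0 hZ; have := macdonald0_gt0 x.
  have := macdonald0_gt0 y.
  move: (Y_norm _ _ _) (Z_norm _) (K0 x) (K0 y) (HL _ x) Hx (HL _ y) (heat _ _ _).
  move=> p n kx ky hx hx0 hy h ky0 kx0 n0 p0.
  by field; rewrite hx0 (gt_eqF kx0) (gt_eqF ky0) (gt_eqF n0) (gt_eqF p0).
have mZk : measurable_fun setT (fun w => \int[mu]_y (f y * (Z_kernel (t - s) (Z s w) y)%:E))%E.
  apply: (@measurable_fun_fubini_tonelli_F _ _ _ _ _ mu
    (fun z : TZ * R => f z.2 * (Z_kernel (t - s) (Z s z.1) z.2)%:E)%E).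
    apply: emeasurable_funM; first exact: (measurableT_comp mf measurable_snd).
    apply/measurable_EFinP; apply: (measurableT_comp (measurable_Z_kernel (t - s))
      (g := fun z : TZ * R => (Z s z.1, z.2))).
    apply: measurable_fun_pair => //.
    exact: (measurableT_comp (measurable_funPT (Z s)) measurable_fst).
  by move=> z; rewrite mule_ge0// lee_fin (Z_kernel_ge0 c0 hZ)// subr_gt0.
apply: ge0_ae_eq_integral => //.
- apply: measurable_funTS; apply: emeasurable_funM; last exact: measurable_YZ_densityZ.
  exact: (measurableT_comp mq (measurable_funPT (Z s))).
- exact: measurable_funTS.
- by move=> w _; rewrite mule_ge0// lee_fin YZ_density_ge0.
- move=> w _; apply: integral_ge0 => y _; rewrite mule_ge0// lee_fin (Z_kernel_ge0 c0 hZ)// subr_gt0//.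
(* The cancellation divides by [HL (tau - s) x]; where this is [0] the left-hand side is [0] by
   convention, so the identity is claimed only outside this null set. *)
exists (Z s @^-1` [set x | HL (tau - s) x = 0]); split.
- apply: measurable_preimage_RV.
  rewrite (_ : [set x | _] = HL (tau - s) @^-1` [set 0])//.
  rewrite -[X in measurable X]setTI; apply: measurable_heat_laplace => //.
- by apply: (heat_laplace_eq0_null c0 hZ) => //; rewrite subr_gt0.
- move=> w /= nw; apply: contrapT => /eqP Hw; apply: nw => _.
  exact: pointwise.
Qed.

Lemma h_transform_le s t AY AZ : 0 <= s -> s <= t -> t < tau ->
  h_transform s AY AZ -> h_transform t AY AZ.
Proof.
move=> s0; rewrite le_eqVlt => /predU1P[->//|st tt]; exact: h_transform_lt.
Qed.

(** Induction on the number [k] of constraints imposed: advance to the next time, then intersect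
    with the constraint there. A last advance reaches [S], so that one density serves all times. *)
Lemma h_transform_box n (t : 'I_n -> R) (S : R) (B : 'I_n -> set R) :
  (forall i, 0 <= t i) -> (forall i j : 'I_n, (i < j)%N -> t i < t j) ->
  (forall i, t i <= S) -> 0 <= S -> S < tau -> (forall i, measurable (B i)) ->
  (PY (joint Y t @^-1` tuple_box B) =
   \int[PZ]_(w in joint Z t @^-1` tuple_box B) (D S (Z S w))%:E)%E.
Proof.
move=> t0 tincr tS S0 Stau mB.
pose EY k : set TY := [set w | forall i : 'I_n, (i < k)%N -> B i (Y (t i) w)].
pose EZ k : set TZ := [set w | forall i : 'I_n, (i < k)%N -> B i (Z (t i) w)].
have key k : (k <= n)%N -> exists s, [/\ 0 <= s, s <= S,
    forall i : 'I_n, (k <= i)%N -> s <= t i & h_transform s (EY k) (EZ k)].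
  elim: k => [_|k IH kn].
    have EY0 : EY 0%N = setT by apply/seteqP; split => [//|w _ i]; rewrite ltn0.
    have EZ0 : EZ 0%N = setT by apply/seteqP; split => [//|w _ i]; rewrite ltn0.
    exists 0; rewrite EY0 EZ0; split; [exact: lexx|exact: S0| |exact: h_transform0].
    by move=> i _; exact: t0.
  have [s [s0 sS st hs]] := IH (ltnW kn).
  pose i0 := Ordinal kn.
  exists (t i0); split; [exact: t0|exact: tS| |].
    by move=> i ki; exact/ltW/tincr.
  have -> : EY k.+1 = EY k `&` Y (t i0) @^-1` B i0.
    apply/seteqP; split => [w h|w [h h0] i].
      by split; [move=> i ik; apply: h; exact: ltnW|exact: h].
    rewrite ltnS leq_eqVlt => /predU1P[ik|/h//].
    by rewrite (_ : i = i0)//; exact: val_inj.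
  have -> : EZ k.+1 = EZ k `&` Z (t i0) @^-1` B i0.
    apply/seteqP; split => [w h|w [h h0] i].
      by split; [move=> i ik; apply: h; exact: ltnW|exact: h].
    rewrite ltnS leq_eqVlt => /predU1P[ik|/h//].
    by rewrite (_ : i = i0)//; exact: val_inj.
  have ttau : t i0 < tau by exact: le_lt_trans Stau.
  apply: h_transformI; [exact: t0|exact: ltW|exact: mB|].
  by apply: (h_transform_le s0 _ ttau hs); exact: st.
have [s [s0 sS _ hs]] := key n (leqnn n).
have [_ _ /(_ setT measurableT)] := h_transform_le s0 sS Stau hs.
rewrite !preimage_setT !setIT.
rewrite (_ : EY n = joint Y t @^-1` tuple_box B); last first.
  apply/seteqP; split => w /= h i; first by rewrite tnth_mktuple; exact: h.
  by move=> _; have := h i; rewrite tnth_mktuple.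
rewrite (_ : EZ n = joint Z t @^-1` tuple_box B)//.
apply/seteqP; split => w /= h i; first by rewrite tnth_mktuple; exact: h.
by move=> _; have := h i; rewrite tnth_mktuple.
Qed.

End HTransform.

(** * Convergence of the finite-dimensional laws *)

Section WeakLimit.
Set Implicit Arguments.
Unset Strict Implicit.
Context {R : realType}.
Local Notation mu := (@lebesgue_measure R).
Local Notation K0 := (macdonald 0).

Lemma bounded_integrable_probability d (T : measurableType d) (P : probability T R)
    (f : T -> R) (M : R) : measurable_fun setT f -> (forall w, `|f w| <= M) ->
  P.-integrable setT (EFin \o f).
Proof.
move=> mf fM; apply: (@le_integrable_EFin R _ _ P _ f (cst M)) => //.
exact: finite_measure_integrable_cst.
Qed.

Lemma Rintegral_cst_probability d (T : measurableType d) (P : probability T R)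
    (M : R) : \int[P]_w cst M w = M.
Proof.
rewrite Rintegral_cst// (_ : fine _ = 1) ?mulr1//.
exact: (congr1 fine (probability_setT P)).
Qed.

(** * Limit and uniform bound of the density *)

Section Density.
Context (a c : R) (a0 : 0 < a) (c0 : 0 < c).
Context {d : measure_display} {T : measurableType d} (P : probability T R).
Context (Z : R -> {RV P >-> R}).
Context (hZ : markov_process `[0, +oo[ Z (Z_initial_density c) Z_transition_density).

Lemma mass_div_Y_norm_cvg s : 0 <= s ->
  kernel_mass (t - s) / Y_norm a c t @[t --> +oo] -->
  (macdonald_laplace a * macdonald_laplace c)^-1.
Proof.
move=> s0.
have A0 := macdonald_laplace_gt0 a0; have B0 := macdonald_laplace_gt0 c0.
have h1 : kernel_mass t / kernel_mass (t - s) @[t --> +oo] --> (1 : R).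
  have := cvg_comp _ _ (cvg_addrr (- s)) (@kernel_mass_shift_cvg R s s0).
  by apply: cvg_trans; apply: near_eq_cvg; apply: nearW => t /=; rewrite subrK.
have h2 : Y_norm a c t / kernel_mass t @[t --> +oo] -->
    macdonald_laplace a * macdonald_laplace c.
  exact: laplace2_div_mass_cvg.
have h3 : (Y_norm a c t / kernel_mass t)^-1 * (kernel_mass t / kernel_mass (t - s))^-1
    @[t --> +oo] --> (macdonald_laplace a * macdonald_laplace c)^-1 * 1^-1.
  apply: cvgM; apply: cvgV => //; rewrite ?oner_eq0 ?gt_eqF ?mulr_gt0//.
rewrite invr1 mulr1 in h3; apply: cvg_trans h3; apply: near_eq_cvg.
near=> t.
have t0 : 0 < t by near: t; exact: nbhs_pinfty_gt.
have km0 := kernel_mass_gt0 t0.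
rewrite !invf_div; move: (kernel_mass t) (kernel_mass (t - s)) (Y_norm _ _ _)^-1 km0.
  by move=> k k' y km0; field; rewrite gt_eqF.
Unshelve. all: end_near. Qed.

Lemma YZ_densityE t s x : s < t ->
  YZ_density a c t s x =
  heat_laplace a (t - s) x / kernel_mass (t - s) *
  (kernel_mass (t - s) / Y_norm a c t) / (Z_norm c * K0 x).
Proof.
move=> st; have := kernel_mass_gt0 (_ : 0 < t - s).
rewrite subr_gt0 => /(_ st) km0.
rewrite /YZ_density !invfM.
move: (heat_laplace _ _ _) (kernel_mass _) (Y_norm _ _ _)^-1 (Z_norm c)^-1 (K0 x)^-1 km0.
by move=> h k y z m km0; field; rewrite gt_eqF.
Qed.

(** The factors [macdonald_laplace a] and [K0 x] cancel in the limit, which leaves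
    [1 / (Z_norm c * macdonald_laplace c) = 1]. *)
Lemma YZ_density_cvg s x : 0 <= s ->
  YZ_density a c t s x @[t --> +oo] --> (1 : R).
Proof.
move=> s0.
have A0 := macdonald_laplace_gt0 a0; have B0 := macdonald_laplace_gt0 c0.
have h1 : heat_laplace a (t - s) x / kernel_mass (t - s) @[t --> +oo] -->
    macdonald_laplace a * K0 x.
  exact: (cvg_comp _ _ (cvg_addrr (- s)) (heat_laplace_div_mass_cvg (a := a) (x := x) a0)).
have h2 : heat_laplace a (t - s) x / kernel_mass (t - s) *
    (kernel_mass (t - s) / Y_norm a c t) / (Z_norm c * K0 x) @[t --> +oo] -->
    macdonald_laplace a * K0 x * (macdonald_laplace a * macdonald_laplace c)^-1 /
      (Z_norm c * K0 x).
  apply: cvgMr_tmp; exact: cvgM h1 (mass_div_Y_norm_cvg s0).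
move: h2; rewrite (_ : _ / (_ * K0 x) = 1); last first.
  have ZB := Z_norm_laplace c0 hZ; have k0 := macdonald0_gt0 x.
  have Z0 := Z_norm_gt0 c0 hZ.
  move: (macdonald_laplace a) (macdonald_laplace c) (Z_norm c) (K0 x) A0 B0 ZB k0 Z0.
  move=> A B n k A0 B0 nB k0 n0.
  rewrite -[RHS]invr1 -[in RHS]nB; field.
  by rewrite !gt_eqF.
move=> h2; apply: cvg_trans h2; apply: near_eq_cvg; near=> t; rewrite YZ_densityE//.
by near: t; apply: nbhs_pinfty_gt; exact: num_real.
Unshelve. all: end_near. Qed.

(** The bound on [heat_laplace] is proportional to [K0 x], which cancels the denominator; the result
    is uniform in [x]. *)
Lemma YZ_density_le t s x : 0 <= s -> s < t ->
  `|YZ_density a c t s x| <=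
  `|kernel_mass (t - s) / Y_norm a c t| * (macdonald_laplace a / Z_norm c).
Proof.
move=> s0 st; have ts0 : 0 < t - s by rewrite subr_gt0.
have k0 := macdonald0_gt0 x; have Z0 := Z_norm_gt0 c0 hZ.
have km0 := kernel_mass_gt0 ts0.
rewrite YZ_densityE// 2!normrM mulrAC mulrC ler_wpM2l//.
rewrite normfV (gtr0_norm (mulr_gt0 Z0 k0)) ler_pdivrMr ?mulr_gt0//.
rewrite normrM normfV (gtr0_norm km0) ler_pdivrMr//.
apply: le_trans (heat_laplace_le x a0 ts0) _.
rewrite mulrA divfK ?gt_eqF//.
by rewrite le_eqVlt; apply/orP; left; apply/eqP; ring.
Qed.

End Density.

Lemma Rintegral_joint_law d (T : measurableType d) (P : probability T R)
    (X : R -> {RV P >-> R}) n (t : 'I_n -> R) (h : n.-tuple R -> R) (M : R) :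
  measurable_fun setT h -> (forall v, `|h v| <= M) ->
  \int[joint_law X t]_v h v = \int[P]_w h (joint X t w).
Proof.
move=> mh hM; congr fine.
have mEh : measurable_fun setT (EFin \o h) by exact/measurable_EFinP.
have iEh : P.-integrable setT ((EFin \o h) \o joint X t).
  apply: (@bounded_integrable_probability _ _ P (h \o joint X t) M) => [|w].
    exact: (measurableT_comp mh (measurable_joint X t)).
  exact: hM.
exact: (integral_distribution mEh iEh).
Qed.

(** Adding [M] makes the test function nonnegative, as the change of measure requires. The term
    subtracted is [M] times the total mass [1] of [PY]. *)
Lemma Rintegral_joint_change (a c tau : R) dY (TY : measurableType dY)
    (PY : probability TY R) (Y : R -> {RV PY >-> R}) dZ (TZ : measurableType dZ)
    (PZ : probability TZ R) (Z : R -> {RV PZ >-> R})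
    n (t : 'I_n -> R) (S : R) (h : n.-tuple R -> R) (M : R) :
  0 < a -> 0 < c ->
  markov_process `[0, tau] Y (Y_initial_density a c tau) (Y_transition_density a tau) ->
  markov_process `[0, +oo[ Z (Z_initial_density c) Z_transition_density ->
  (forall i, 0 <= t i) -> (forall i j : 'I_n, (i < j)%N -> t i < t j) ->
  (forall i, t i <= S) -> 0 <= S -> S < tau ->
  measurable_fun setT h -> (forall v, `|h v| <= M) ->
  \int[joint_law Y t]_v h v =
  \int[PZ]_w ((h (joint Z t w) + M) * YZ_density a c tau S (Z S w)) - M.
Proof.
move=> a0 c0 hY hZ t0 tincr tS S0 Stau mh hM.
have tau0 := le_lt_trans S0 Stau.
have mhY : measurable_fun setT (h \o joint Y t).
  exact: (measurableT_comp mh (measurable_joint Y t)).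
have iY : PY.-integrable setT (EFin \o (h \o joint Y t)).
  by apply: (@bounded_integrable_probability _ _ PY _ M mhY) => w; exact: hM.
have iM : PY.-integrable setT (EFin \o cst M) by exact: finite_measure_integrable_cst.
rewrite (Rintegral_joint_law Y t mh hM); apply/eqP; rewrite eq_sym subr_eq; apply/eqP.
have -> : \int[PY]_w h (joint Y t w) + M = \int[PY]_w (h (joint Y t w) + M).
  rewrite (RintegralD _ iY iM)//; congr (_ + _).
  by rewrite (Rintegral_cst_probability PY).
pose f v : \bar R := (h v + M)%:E.
have mf : measurable_fun setT f.
  by apply/measurable_EFinP; apply: measurable_funD.
have f0 v : (0 <= f v)%E.
  by rewrite lee_fin -lerBlDr sub0r lerNl (le_trans _ (hM v))// -normrN ler_norm.
have mk := measurable_YZ_densityZ a0 c0 tau0 hY hZ S.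
have k0 w : (0 <= (YZ_density a c tau S (Z S w))%:E)%E.
  by rewrite lee_fin (YZ_density_ge0 a0 c0 tau0 hY hZ).
have law := tuple_law_eq (X1 := joint Y t) (measurable_joint Z t) mk k0
  (fun B => h_transform_box a0 c0 tau0 hY hZ t0 tincr tS S0 Stau).
have H := @eq_weighted_integral R _ _ _ _ _ _ PY PZ setT setT (joint Y t) (joint Z t)
  (cst 1%E) _ measurableT measurableT (measurable_joint Y t) (measurable_joint Z t)
  (measurable_cst _) mk (fun _ => lee01) k0 _ f mf f0.
rewrite /Rintegral; congr fine; symmetry.
transitivity (\int[PY]_w (f (joint Y t w) * cst 1 w))%E.
  by apply: eq_integral => w _; rewrite /= mule1.
rewrite H; first by apply: eq_integral => w _.
move=> E mE; rewrite !setTI integral_cst ?mul1e; first exact: law.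
by rewrite -[X in measurable X]setTI; exact: measurable_joint.
Qed.

End WeakLimit.

Theorem theorem2p3 (R : realType) (a c : R) (ha : 0 < a) (hc : 0 < c)
  (d : R -> measure_display) (T : forall tau : R, measurableType (d tau))
  (P : forall tau : R, probability (T tau) R)
  (Y : forall tau : R, R -> {RV (P tau) >-> R})
  (hY : forall tau : R, 0 < tau ->
     markov_process `[0, tau] (Y tau)
       (Y_initial_density a c tau) (Y_transition_density a tau))
  (dZ : measure_display) (TZ : measurableType dZ) (PZ : probability TZ R)
  (Z : R -> {RV PZ >-> R})
  (hZ : markov_process `[0, +oo[ Z
     (Z_initial_density c) Z_transition_density)
  (n : nat) (t : 'I_n -> R)
  (t_ge0 : forall i, 0 <= t i)
  (t_incr : forall i j : 'I_n, (i < j)%N -> t i < t j) :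
  weakly_converges (fun tau => joint_law (Y tau) t) (joint_law Z t).
Proof.
move=> g cg [M gM].
pose h (v : n.-tuple R) : R := g (\row_i tnth v i).
have mh : measurable_fun setT h by exact: measurable_tuple_cvg.
have hM v : `|h v| <= M by exact: gM.
(* A common upper bound of the times that also makes sense for [n = 0]. *)
pose S := \sum_i t i.
have S0 : 0 <= S by exact: sumr_ge0.
have tS i : t i <= S by rewrite /S (bigD1 i)//= lerDl sumr_ge0.
have mhZ : measurable_fun setT (fun w => h (joint Z t w)).
  exact: (measurableT_comp mh (measurable_joint Z t)).
rewrite (Rintegral_joint_law Z t mh hM).
apply: (cvg_pinfty_gt_seq (b := S)) => v vS voo.
have v0 k : 0 < v k by exact: le_lt_trans (vS k).
have E k : \int[joint_law (Y (v k)) t]_x g (\row_i tnth x i) =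
    \int[PZ]_w ((h (joint Z t w) + M) * YZ_density a c (v k) S (Z S w)) - M.
  exact: (Rintegral_joint_change ha hc (hY (v k) (v0 k)) hZ t_ge0 t_incr tS S0 (vS k) mh hM).
under eq_fun do rewrite E.
have -> : \int[PZ]_w h (joint Z t w) = \int[PZ]_w (h (joint Z t w) + M) - M.
  rewrite (@RintegralD _ _ _ PZ setT (fun w => h (joint Z t w)) (cst M))//.
  - by rewrite (Rintegral_cst_probability PZ) addrK.
  - exact: bounded_integrable_probability.
  - exact: finite_measure_integrable_cst.
apply: cvgB; last exact: cvg_cst.
(* A convergent sequence is bounded; with [YZ_density_le] this bounds the densities uniformly in the
   index and the position. *)
have [B hB] : exists B, forall k, `|kernel_mass (v k - S) / Y_norm a c (v k)| <= B.
  have : cvg (kernel_mass (v k - S) / Y_norm a c (v k) @[k --> \oo]).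
    apply/cvg_ex; eexists.
    have /cvg_pinftyP := mass_div_Y_norm_cvg ha hc S0; exact.
  move=> /cvg_seq_bounded/pinfty_ex_gt0[B B0 /= uB]; exists B => k; exact: uB.
have Dle k w : `|YZ_density a c (v k) S (Z S w)| <=
    B * (macdonald_laplace a / Z_norm c).
  apply: (le_trans (YZ_density_le ha hc hZ _ S0 (vS k))).
  rewrite ler_wpM2r// divr_ge0 ?(ltW (macdonald_laplace_gt0 ha))//.
  exact/ltW/(Z_norm_gt0 hc hZ).
apply: (@dominated_cvg_Rintegral R _ _ PZ setT _ _
  (cst ((M + M) * (B * (macdonald_laplace a / Z_norm c))))) => //.
- move=> k; apply: measurable_funM; first exact: measurable_funD.
  apply/measurable_EFinP.
  exact: (measurable_YZ_densityZ ha hc (v0 k) (hY (v k) (v0 k)) hZ S).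
- move=> w _; rewrite -[X in _ --> X]mulr1; apply: cvgMl_tmp.
  by have /cvg_pinftyP := YZ_density_cvg ha hc hZ (Z S w) S0; exact.
- exact: finite_measure_integrable_cst.
- move=> k w _; rewrite normrM; apply: ler_pM => //.
  have M0 : 0 <= M by exact: le_trans (hM (joint Z t w)).
  by rewrite (le_trans (ler_normD _ _))// lerD// ger0_norm.
Qed.
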